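(* Let $X$ and $Y$ be locally compact spaces, neither of which is realcompact. If $(\mathscr{R}(X),\leq)$ and $(\mathscr{R}(Y),\leq)$ are order-isomorphic, then $(\beta X\setminus X)\setminus\mathrm{cl}_{\beta X}(\upsilon X\setminus X)$ and $(\beta Y\setminus Y)\setminus\mathrm{cl}_{\beta Y}(\upsilon Y\setminus Y)$ are homeomorphic.
   Context: All spaces are completely regular Hausdorff. $\beta X$ is the Stone–Čech compactification and $\upsilon X\subseteq\beta X$ the Hewitt realcompactification of $X$. An extension of $X$ is a space containing $X$ as a dense subspace; its remainder is $Y\setminus X$. Extensions are identified up to homeomorphisms fixing $X$ pointwise, and $Y\leq Y'$ means there is a continuous map $Y'\to Y$ fixing $X$ pointwise. A space is realcompact if it is homeomorphic to a closed subspace of a power of $\mathbb{R}$. $\mathscr{R}(X)$ denotes the set of all realcompact extensions of $X$ with compact remainder, partially ordered by $\leq$. *)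

(* Defs.v *)
From Stdlib Require Import Reals List.
Open Scope R_scope.

Record space := Space {
  pt :> Type;
  is_open : (pt -> Prop) -> Prop;
  open_ext : forall A B : pt -> Prop,
      (forall x, A x <-> B x) -> is_open A -> is_open B;
  open_full : is_open (fun _ => True);
  open_inter : forall A B, is_open A -> is_open B -> is_open (fun x => A x /\ B x);
  open_union : forall F : (pt -> Prop) -> Prop,
      (forall A, F A -> is_open A) -> is_open (fun x => exists A, F A /\ A x)
}.
Arguments is_open {s} _.

Definition is_closed {X : space} (C : X -> Prop) : Prop :=
  is_open (fun x => ~ C x).

Definition closure {X : space} (S : X -> Prop) (p : X) : Prop :=
  forall U, is_open U -> U p -> exists q, U q /\ S q.

Definition continuous {X Y : space} (f : X -> Y) : Prop :=
  forall V : Y -> Prop, is_open V -> is_open (fun x => V (f x)).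

Definition hausdorff (X : space) : Prop :=
  forall x y : X, x <> y -> exists U V : X -> Prop,
    is_open U /\ is_open V /\ U x /\ V y /\ forall z, ~ (U z /\ V z).

Definition R_open (V : R -> Prop) : Prop :=
  forall x, V x -> exists eps, eps > 0 /\ forall y, Rabs (y - x) < eps -> V y.

Definition continuous_R {X : space} (f : X -> R) : Prop :=
  forall V, R_open V -> is_open (fun x => V (f x)).

Definition rel_continuous_R {X : space} (S : X -> Prop) (g : X -> R) : Prop :=
  forall V, R_open V -> exists U : X -> Prop, is_open U /\
    forall q, S q -> (V (g q) <-> U q).

Definition tychonoff (X : space) : Prop :=
  hausdorff X /\
  forall (C : X -> Prop) (x : X), is_closed C -> ~ C x ->
    exists f : X -> R, continuous_R f /\ f x = 0 /\ forall y, C y -> f y = 1.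

Definition compact_set {X : space} (S : X -> Prop) : Prop :=
  forall F : (X -> Prop) -> Prop,
    (forall U, F U -> is_open U) ->
    (forall x, S x -> exists U, F U /\ U x) ->
    exists l : list (X -> Prop),
      (forall U, In U l -> F U) /\ (forall x, S x -> exists U, In U l /\ U x).

Definition compact (X : space) : Prop := compact_set (fun _ : X => True).

Definition locally_compact (X : space) : Prop :=
  forall x : X, exists (U C : X -> Prop),
    is_open U /\ U x /\ compact_set C /\ forall y, U y -> C y.

Definition embedding {X Y : space} (f : X -> Y) : Prop :=
  continuous f /\ (forall x y, f x = f y -> x = y) /\
  forall U : X -> Prop, is_open U ->
    exists V : Y -> Prop, is_open V /\ forall x, U x <-> V (f x).

Definition dense_range {X Y : space} (f : X -> Y) : Prop :=
  forall U : Y -> Prop, is_open U -> (exists p, U p) -> exists x, U (f x).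

Definition prod_open {I : Type} (V : (I -> R) -> Prop) : Prop :=
  forall y, V y -> exists (l : list I) (eps : R), eps > 0 /\
    forall y', (forall i, In i l -> Rabs (y' i - y i) < eps) -> V y'.

Definition realcompact (X : space) : Prop :=
  exists (I : Type) (h : X -> (I -> R)),
    (forall V, prod_open V -> is_open (fun x => V (h x))) /\
    (forall x y, h x = h y -> x = y) /\
    (forall U : X -> Prop, is_open U ->
       exists V, prod_open V /\ forall x, U x <-> V (h x)) /\
    prod_open (fun y => ~ exists x, h x = y).

Record extension (X : space) := Extension {
  ext_sp : space;
  ext_emb : X -> ext_sp;
  ext_tych : tychonoff ext_sp;
  ext_embedding : embedding ext_emb;
  ext_dense : dense_range ext_emb
}.
Arguments ext_sp {X} _.
Arguments ext_emb {X} _ _.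

Definition remainder {X : space} (E : extension X) (p : ext_sp E) : Prop :=
  ~ exists x, ext_emb E x = p.

Definition ext_le {X : space} (E E' : extension X) : Prop :=
  exists phi : ext_sp E' -> ext_sp E,
    continuous phi /\ forall x, phi (ext_emb E' x) = ext_emb E x.

Definition in_RX {X : space} (E : extension X) : Prop :=
  realcompact (ext_sp E) /\ compact_set (remainder E).

Definition RX (X : space) := { E : extension X | in_RX E }.

Definition RX_le {X : space} (a b : RX X) : Prop := ext_le (proj1_sig a) (proj1_sig b).

(** order isomorphism of the posets (R(X),<=) and (R(Y),<=), where
    extensions are identified when equivalent (a <= b and b <= a). *)
Definition RX_order_isomorphic (X Y : space) : Prop :=
  exists (F : RX X -> RX Y) (G : RX Y -> RX X),
    (forall a b, RX_le a b <-> RX_le (F a) (F b)) /\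
    (forall a, RX_le a (G (F a)) /\ RX_le (G (F a)) a) /\
    (forall c, RX_le c (F (G c)) /\ RX_le (F (G c)) c).

Definition stone_cech (X K : space) (e : X -> K) : Prop :=
  compact K /\ hausdorff K /\ embedding e /\ dense_range e /\
  forall f : X -> R, continuous_R f -> (exists M, forall x, Rabs (f x) <= M) ->
    exists g : K -> R, continuous_R g /\ forall x, g (e x) = f x.

(** Hewitt realcompactification inside beta X: points p of beta X to which
    every f in C(X) extends continuously on X u {p}. *)
Definition in_upsilon {X K : space} (e : X -> K) (p : K) : Prop :=
  forall f : X -> R, continuous_R f ->
    exists g : K -> R,
      rel_continuous_R (fun q => (exists x, e x = q) \/ q = p) g /\
      forall x, g (e x) = f x.

Definition key_set {X K : space} (e : X -> K) (p : K) : Prop :=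
  (~ exists x, e x = p) /\
  ~ closure (fun q => in_upsilon e q /\ ~ exists x, e x = q) p.

Definition rel_cont {K L : space} {A : K -> Prop} {B : L -> Prop}
  (f : {p | A p} -> {q | B q}) : Prop :=
  forall V : L -> Prop, is_open V -> exists U : K -> Prop, is_open U /\
    forall a, V (proj1_sig (f a)) <-> U (proj1_sig a).

Definition homeomorphic_subspaces {K L : space} (A : K -> Prop) (B : L -> Prop) : Prop :=
  exists (f : {p | A p} -> {q | B q}) (g : {q | B q} -> {p | A p}),
    (forall a, g (f a) = a) /\ (forall b, f (g b) = b) /\ rel_cont f /\ rel_cont g.

(* Main.v *)
From Stdlib Require Import Reals List Lra Lia Arith Classical ClassicalEpsilon.
From Stdlib Require Import ProofIrrelevance FunctionalExtensionality.
Require Import Defs.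

(** An extension E in R(X) is encoded by the partial equivalence relation on beta X relating two
    points whose neighbourhood traces on X converge to the same point of E. Its domain is X u C with
    C closed, disjoint from X and containing C0 = cl(upsilon X \ X), and E <= E' iff the relation of
    E' is contained in that of E. Conversely every such C occurs with the identity relation, and also
    with two of its points glued. So the largest element is X u C0, and a coatom either adds to it a
    point p of (beta X \ X) \ C0 or glues two points of C0. The former are recognised by the order,
    because C0 is nonempty when X is not realcompact: below the coatom of p lies the extension in
    which p is glued to a point of C0, and no other coatom is above it. Hence an order isomorphism
    induces a bijection between the two spaces. The points whose coatom lies above a given E form the
    set C \ C0, and these sets are exactly the relatively closed ones, so the bijection is a
    homeomorphism. *)

(** * Open sets and compactness *)

(** The relation determines E because the limit map, from its domain in beta X onto E, is continuous
    and closed. Both properties come from bounded functions on E, which restrict to X and then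
    extend over beta X. Containment of relations therefore yields a continuous map between
    extensions. In the converse construction the obstacle is realcompactness of the quotient of X u
    C: every point p outside X u C must be sent to infinity by a continuous function that is
    constant on classes. A point off upsilon X is a zero of some function on beta X that is positive
    on X. Adding a Urysohn function that is 1 on C and truncating at 1 makes this function constant
    on C, whatever the decomposition of C, and its reciprocal is the required function. *)

Lemma open_local {X : space} (A : X -> Prop) :
  (forall x, A x -> exists U, is_open U /\ U x /\ forall y, U y -> A y) -> is_open A.
Proof.
  intros H.
  apply open_ext with (fun x => exists U, (is_open U /\ forall y, U y -> A y) /\ U x).
  - intros x; split.
    + intros (U & (_ & HU) & Ux); auto.
    + intros Ax; destruct (H x Ax) as (U & oU & Ux & HU); eauto.
  - apply (open_union X (fun U => is_open U /\ forall y, U y -> A y)).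
    intros U [oU _]; exact oU.
Qed.

Lemma open_or {X : space} (A B : X -> Prop) :
  is_open A -> is_open B -> is_open (fun x => A x \/ B x).
Proof.
  intros oA oB; apply open_local; intros x [Ax|Bx].
  - exists A; auto.
  - exists B; auto.
Qed.

Lemma closed_or {X : space} (A B : X -> Prop) :
  is_closed A -> is_closed B -> is_closed (fun x => A x \/ B x).
Proof.
  intros cA cB; apply open_ext with (fun x => ~ A x /\ ~ B x).
  - intros x; tauto.
  - apply open_inter; auto.
Qed.

Lemma closed_and {X : space} (A B : X -> Prop) :
  is_closed A -> is_closed B -> is_closed (fun x => A x /\ B x).
Proof.
  intros cA cB; apply open_ext with (fun x => ~ A x \/ ~ B x).
  - intros x; tauto.
  - apply open_or; auto.
Qed.

Lemma closed_not {X : space} (A : X -> Prop) :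
  is_open A -> is_closed (fun x => ~ A x).
Proof. apply open_ext; intros x; tauto. Qed.

Lemma closed_closure {X : space} (S : X -> Prop) : is_closed (closure S).
Proof.
  apply open_local; intros x nx.
  apply not_all_ex_not in nx; destruct nx as [U nU].
  apply imply_to_and in nU; destruct nU as [oU nU].
  apply imply_to_and in nU; destruct nU as [Ux nU].
  exists U; split; [auto|split; [auto|]].
  intros y Uy Hy; apply nU; apply (Hy U); auto.
Qed.

Lemma closure_incl {X : space} (S : X -> Prop) x : S x -> closure S x.
Proof. intros Sx U _ Ux; eauto. Qed.

Lemma closure_min {X : space} (S C : X -> Prop) :
  is_closed C -> (forall x, S x -> C x) -> forall x, closure S x -> C x.
Proof.
  intros cC H x Hx; apply NNPP; intros nC.
  destruct (Hx _ cC nC) as (q & nq & Sq); auto.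
Qed.

Lemma closed_compact_set {K : space} (S : K -> Prop) :
  compact K -> is_closed S -> compact_set S.
Proof.
  intros cK cS F oF cov.
  destruct (cK (fun U => F U \/ U = (fun x => ~ S x))) as (l & lF & lcov).
  - intros U [FU| ->]; auto.
  - intros x _; destruct (classic (S x)) as [Sx|nS].
    + destruct (cov x Sx) as (U & FU & Ux); eauto.
    + exists (fun x => ~ S x); auto.
  - exists (filter (fun U => if excluded_middle_informative (F U) then true else false) l).
    split.
    + intros U HU; apply filter_In in HU; destruct HU as [_ HU].
      destruct (excluded_middle_informative (F U)); [auto|discriminate].
    + intros x Sx; destruct (lcov x I) as (U & iU & Ux).
      destruct (lF U iU) as [FU| ->]; [|contradiction].
      exists U; split; [apply filter_In; split; auto|auto].
      destruct (excluded_middle_informative (F U)); [auto|contradiction].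
Qed.

(** The tube-lemma pattern: [P] survives shrinking of its second argument, so the intersection of
    the finitely many neighbourhoods of z that go with a finite subcover serves all its members. S
    and z may lie in different spaces, since the lemma is applied between K and an extension in both
    directions. *)
Lemma compact_set_uniform {X Z : space} (S : X -> Prop) (z : Z)
  (P : (X -> Prop) -> (Z -> Prop) -> Prop) :
  compact_set S ->
  (forall V U U', P V U -> (forall t, U' t -> U t) -> P V U') ->
  (forall s, S s -> exists V U, is_open V /\ V s /\ is_open U /\ U z /\ P V U) ->
  exists U, is_open U /\ U z /\
    exists l, (forall s, S s -> exists V, In V l /\ V s) /\
              (forall V, In V l -> is_open V /\ P V U).
Proof.
  intros cS mono H.
  destruct (cS (fun V => is_open V /\ exists U, is_open U /\ U z /\ P V U)) as (l & lF & lcov).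
  - intros V [oV _]; exact oV.
  - intros s Ss; destruct (H s Ss) as (V & U & oV & Vs & oU & Uz & HP).
    exists V; repeat split; eauto.
  - assert (HU : exists U, is_open U /\ U z /\ forall V, In V l -> is_open V /\ P V U).
    { clear lcov; induction l as [|V l IH].
      - exists (fun _ => True); repeat split; [apply open_full| |]; contradiction.
      - destruct IH as (U & oU & Uz & HU); [intros; apply lF; right; auto|].
        destruct (lF V (or_introl eq_refl)) as (oV & U' & oU' & U'z & HV).
        exists (fun t => U t /\ U' t); split; [apply open_inter; auto|split; [auto|]].
        intros V' [<-|iV'].
        + split; [auto|]; apply (mono _ U'); [auto|tauto].
        + destruct (HU V' iV') as [oV' PV']; split; [auto|].
          apply (mono _ U); [auto|tauto]. }
    destruct HU as (U & oU & Uz & HU); exists U; split; [auto|split; [auto|]].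
    exists l; auto.
Qed.

(** Finite choice. It turns a finite subcover by preimages or traces back into a finite part of the
    original cover. *)
Lemma list_witnesses {A B : Type} (l : list A) (P : A -> B -> Prop) :
  (forall a, In a l -> exists b, P a b) ->
  exists l', (forall b, In b l' -> exists a, In a l /\ P a b) /\
             (forall a, In a l -> exists b, In b l' /\ P a b).
Proof.
  induction l as [|a l IH]; intros H.
  - exists nil; split; intros ? [].
  - destruct IH as (l' & h1 & h2); [intros; apply H; right; auto|].
    destruct (H a (or_introl eq_refl)) as (b & Pb).
    exists (b :: l'); split.
    + intros c [<-|h]; [exists a; simpl; auto|].
      destruct (h1 c h) as (a' & h3 & h4); exists a'; simpl; auto.
    + intros c [<-|h]; [exists b; simpl; auto|].
      destruct (h2 c h) as (b' & h3 & h4); exists b'; simpl; auto.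
Qed.

Lemma compact_point_separation {K : space} (S : K -> Prop) (x : K) :
  hausdorff K -> compact_set S -> ~ S x ->
  exists U V : K -> Prop, is_open U /\ is_open V /\ U x /\ (forall s, S s -> V s) /\
    forall z, ~ (U z /\ V z).
Proof.
  intros hK cS nS.
  destruct (compact_set_uniform S x (fun V U => forall t, ~ (U t /\ V t)) cS)
    as (U & oU & Ux & l & lcov & lP).
  - intros V U U' H1 H2 t [h1 h2]; apply (H1 t); auto.
  - intros s Ss; destruct (hK s x) as (V & U & oV & oU & Vs & Ux & HUV).
    { intros ->; contradiction. }
    exists V, U; repeat split; auto. intros t [h1 h2]; apply (HUV t); auto.
  - exists U, (fun t => exists V, In V l /\ V t); repeat split; auto.
    + apply (open_union K (fun V => In V l)); intros V iV; apply lP; auto.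
    + intros z (Uz & V & iV & Vz); destruct (lP V iV) as [_ h]; apply (h z); auto.
Qed.

Lemma compact_set_closed {K : space} (S : K -> Prop) :
  hausdorff K -> compact_set S -> is_closed S.
Proof.
  intros hK cS; apply open_local; intros x nS.
  destruct (compact_point_separation S x hK cS nS) as (U & V & oU & oV & Ux & HV & HUV).
  exists U; split; [auto|split; [auto|]].
  intros y Uy Sy; apply (HUV y); auto.
Qed.

Lemma closed_point {K : space} (x : K) : hausdorff K -> is_closed (fun y => y = x).
Proof.
  intros hK; apply open_local; intros y ny.
  destruct (hK y x ny) as (U & V & oU & oV & Uy & Vx & HUV).
  exists U; split; [auto|split; [auto|]].
  intros z Uz ->; apply (HUV x); auto.
Qed.

Lemma compact_hausdorff_normal {K : space} (A V : K -> Prop) :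
  compact K -> hausdorff K -> is_closed A -> is_open V -> (forall x, A x -> V x) ->
  exists W, is_open W /\ (forall x, A x -> W x) /\ forall x, closure W x -> V x.
Proof.
  intros cK hK cA oV AV.
  destruct (closed_compact_set A cK cA
    (fun W => is_open W /\ forall x, closure W x -> V x)) as (l & lF & lcov).
  - intros W [oW _]; exact oW.
  - intros x Ax.
    destruct (compact_point_separation (fun y => ~ V y) x hK) as (U & U' & oU & oU' & Ux & HU' & dis).
    + apply closed_compact_set; auto; apply closed_not; auto.
    + intros h; apply h; auto.
    + exists U; repeat split; auto.
      intros y cy; apply NNPP; intros nV.
      destruct (cy U' oU' (HU' y nV)) as (q & q1 & q2); apply (dis q); auto.
  - exists (fun x => exists W, In W l /\ W x); split; [|split; [exact lcov|]].
    + apply (open_union K (fun V => In V l)); intros W iW; apply lF; auto.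
    (* A finite union of closures is closed, so it contains the closure of the union. *)
    + assert (H : is_closed (fun x => exists W, In W l /\ closure W x)).
      { clear; induction l as [|W l IH].
        - apply open_ext with (fun _ => True); [|apply open_full].
          intros x; split; [intros _ (W & [] & _)|auto].
        - apply open_ext with (fun x => ~ (closure W x \/ exists W, In W l /\ closure W x)).
          + intros x; apply not_iff_compat; split.
            * intros [h|(W' & h1 & h2)]; [exists W|exists W']; simpl; auto.
            * intros (W' & [<-|h1] & h2); eauto.
          + apply closed_or; auto; apply closed_closure. }
      intros x cx.
      destruct (closure_min _ _ H (fun y '(ex_intro _ W (conj h1 h2)) =>
        ex_intro _ W (conj h1 (closure_incl W y h2))) x cx) as (W & iW & cW).
      apply (proj2 (lF W iW)); auto.
Qed.

(** B is a filter base. Without a cluster point, the open sets that miss some member of B cover K,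
    and a finite subcover produces a member of B that is disjoint from all of K. *)
Lemma compact_cluster_point {K : space} (B : (K -> Prop) -> Prop) :
  compact K -> (exists b, B b) -> (forall b, B b -> exists x, b x) ->
  (forall b b', B b -> B b' -> exists c, B c /\ forall x, c x -> b x /\ b' x) ->
  exists p, forall b, B b -> closure b p.
Proof.
  intros cK [b0 Bb0] ne dir; apply NNPP; intros H.
  destruct (cK (fun U => is_open U /\ exists b, B b /\ forall x, ~ (U x /\ b x))) as (l & lF & lcov).
  - intros U [oU _]; exact oU.
  - intros p _; apply NNPP; intros nU; apply H; exists p; intros b Bb U oU Up.
    apply NNPP; intros nq; apply nU; exists U; split; [split; [auto|]|auto].
    exists b; split; [auto|]; intros x h; apply nq; exists x; exact h.
  - assert (Hb : exists b, B b /\ forall U, In U l -> forall x, ~ (U x /\ b x)).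
    { clear lcov; induction l as [|U l IH].
      - exists b0; split; [auto|intros U []].
      - destruct IH as (b & Bb & Hb); [intros; apply lF; right; auto|].
        destruct (lF U (or_introl eq_refl)) as (_ & b' & Bb' & Hb').
        destruct (dir b b' Bb Bb') as (c & Bc & Hc).
        exists c; split; [auto|]; intros U' [<-|iU'] x [h1 h2]; apply Hc in h2.
        + apply (Hb' x); tauto.
        + apply (Hb U' iU' x); tauto. }
    destruct Hb as (b & Bb & Hb); destruct (ne b Bb) as [x bx].
    destruct (lcov x I) as (U & iU & Ux); apply (Hb U iU x); auto.
Qed.

(** * Real-valued functions *)

Lemma R_open_gt a : R_open (fun t => a < t).
Proof.
  intros x h; exists (x - a); split; [lra|]; intros y Hy; apply Rabs_def2 in Hy; lra.
Qed.

Lemma R_open_lt a : R_open (fun t => t < a).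
Proof.
  intros x h; exists (a - x); split; [lra|]; intros y Hy; apply Rabs_def2 in Hy; lra.
Qed.

Lemma R_open_ball a eps : R_open (fun t => Rabs (t - a) < eps).
Proof.
  intros x h; exists (eps - Rabs (x - a)); split; [lra|]; intros y Hy.
  replace (y - a) with ((y - x) + (x - a)) by ring.
  pose proof (Rabs_triang (y - x) (x - a)); lra.
Qed.

Lemma rel_continuous_R_eps {X : space} (S : X -> Prop) (f : X -> R) :
  (forall x eps, S x -> eps > 0 -> exists U, is_open U /\ U x /\
     forall y, S y -> U y -> Rabs (f y - f x) < eps) ->
  rel_continuous_R S f.
Proof.
  intros H V oV.
  exists (fun x => exists U, (is_open U /\ forall y, S y -> U y -> V (f y)) /\ U x); split.
  - apply (open_union X (fun U => is_open U /\ forall y, S y -> U y -> V (f y))).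
    intros U [oU _]; exact oU.
  - intros q Sq; split.
    + intros Vq; destruct (oV _ Vq) as (eps & he & hV).
      destruct (H q eps Sq he) as (U & oU & Uq & HU); exists U; repeat split; auto.
    + intros (U & (_ & HU) & Uq); auto.
Qed.

Lemma rel_continuous_R_near {X : space} (S : X -> Prop) (f : X -> R) :
  rel_continuous_R S f ->
  forall x eps, S x -> eps > 0 -> exists U, is_open U /\ U x /\
     forall y, S y -> U y -> Rabs (f y - f x) < eps.
Proof.
  intros H x eps Sx he; destruct (H _ (R_open_ball (f x) eps)) as (U & oU & HU).
  exists U; split; [auto|split].
  - apply HU; [auto|]; rewrite Rminus_diag, Rabs_R0; lra.
  - intros y Sy Uy; apply HU; auto.
Qed.

Lemma continuous_R_rel {X : space} (S : X -> Prop) (f : X -> R) :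
  continuous_R f -> rel_continuous_R S f.
Proof. intros H V oV; exists (fun x => V (f x)); split; [auto|tauto]. Qed.

Lemma rel_continuous_R_full {X : space} (f : X -> R) :
  rel_continuous_R (fun _ => True) f -> continuous_R f.
Proof.
  intros H V oV; destruct (H V oV) as (U & oU & HU).
  apply open_ext with U; [|auto]; intros x; symmetry; apply HU; auto.
Qed.

Lemma continuous_R_eps {X : space} (f : X -> R) :
  (forall x eps, eps > 0 -> exists U, is_open U /\ U x /\ forall y, U y -> Rabs (f y - f x) < eps) ->
  continuous_R f.
Proof.
  intros H; apply rel_continuous_R_full, rel_continuous_R_eps; intros x eps _ he.
  destruct (H x eps he) as (U & oU & Ux & HU); exists U; auto.
Qed.

Lemma continuous_R_near {X : space} (f : X -> R) :
  continuous_R f ->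
  forall x eps, eps > 0 -> exists U, is_open U /\ U x /\ forall y, U y -> Rabs (f y - f x) < eps.
Proof.
  intros H x eps he.
  destruct (rel_continuous_R_near (fun _ => True) f (continuous_R_rel _ _ H) x eps I he)
    as (U & oU & Ux & HU); exists U; auto.
Qed.

Lemma continuous_R_lipschitz {X : space} (phi : R -> R) (f : X -> R) :
  (forall s t, Rabs (phi s - phi t) <= Rabs (s - t)) ->
  continuous_R f -> continuous_R (fun x => phi (f x)).
Proof.
  intros lip cf; apply continuous_R_eps; intros x eps he.
  destruct (continuous_R_near f cf x eps he) as (U & oU & Ux & HU); exists U.
  split; [auto|split; [auto|]]; intros y Uy.
  pose proof (lip (f y) (f x)); specialize (HU y Uy); lra.
Qed.

Lemma continuous_R_plus {X : space} (f g : X -> R) :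
  continuous_R f -> continuous_R g -> continuous_R (fun x => f x + g x).
Proof.
  intros cf cg; apply continuous_R_eps; intros x eps he.
  destruct (continuous_R_near f cf x (eps / 2)) as (U & oU & Ux & HU); [lra|].
  destruct (continuous_R_near g cg x (eps / 2)) as (V & oV & Vx & HV); [lra|].
  exists (fun y => U y /\ V y); split; [apply open_inter; auto|split; [auto|]].
  intros y [Uy Vy]; specialize (HU y Uy); specialize (HV y Vy).
  replace (f y + g y - (f x + g x)) with ((f y - f x) + (g y - g x)) by ring.
  pose proof (Rabs_triang (f y - f x) (g y - g x)); lra.
Qed.

Definition clamp (a b t : R) : R := Rmax a (Rmin b t).

Lemma clamp_lipschitz a b s t : Rabs (clamp a b s - clamp a b t) <= Rabs (s - t).
Proof.
  unfold clamp, Rmin; destruct (Rle_dec b s), (Rle_dec b t); unfold Rmax, Rabs;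
    repeat match goal with |- context [Rle_dec ?x ?y] => destruct (Rle_dec x y)
      | |- context [Rcase_abs ?x] => destruct (Rcase_abs x) end; lra.
Qed.

Lemma clamp_bounds a b t : a <= b -> a <= clamp a b t <= b.
Proof.
  intros h; unfold clamp, Rmin; destruct (Rle_dec b t); unfold Rmax;
    match goal with |- context [Rle_dec ?x ?y] => destruct (Rle_dec x y) end; lra.
Qed.

Lemma clamp_id a b t : a <= t <= b -> clamp a b t = t.
Proof.
  intros h; unfold clamp, Rmin; destruct (Rle_dec b t); unfold Rmax;
    match goal with |- context [Rle_dec ?x ?y] => destruct (Rle_dec x y) end; lra.
Qed.

Lemma continuous_R_clamp {X : space} a b (f : X -> R) :
  continuous_R f -> continuous_R (fun x => clamp a b (f x)).
Proof. apply (continuous_R_lipschitz (clamp a b)), clamp_lipschitz. Qed.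

(** The bounds are what allows the restriction of f to X to be extended over beta X. *)
Lemma tychonoff_clamped {X : space} (V : X -> Prop) (x : X) :
  tychonoff X -> is_open V -> V x ->
  exists f : X -> R, continuous_R f /\ f x = 0 /\ (forall y, f y < 1 -> V y) /\
    forall y, 0 <= f y <= 1.
Proof.
  intros [_ H] oV Vx.
  destruct (H (fun y => ~ V y) x) as (f & cf & fx & f1).
  - apply closed_not; auto.
  - tauto.
  - exists (fun y => clamp 0 1 (f y)); repeat split; try (apply clamp_bounds; lra).
    + apply continuous_R_clamp; auto.
    + rewrite fx; apply clamp_id; lra.
    + intros y h; apply NNPP; intros nV; rewrite (f1 y nV), clamp_id in h; lra.
Qed.

(** * Urysohn's lemma for compact Hausdorff spaces *)

Section Urysohn.
Variable K : space.
Hypothesis cK : compact K.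
Hypothesis hK : hausdorff K.

Definition well_inside (U V : K -> Prop) : Prop := forall x, closure U x -> V x.

(** The hypotheses stand behind the existential quantifier, so that choice gives a total operation.
    The recursion defining [dyadic] can then use it before the chain property is available. *)
Lemma interpolant_exists (U V : K -> Prop) :
  exists W, is_open V -> well_inside U V -> is_open W /\ well_inside U W /\ well_inside W V.
Proof.
  destruct (classic (is_open V /\ well_inside U V)) as [[oV UV]|h].
  - destruct (compact_hausdorff_normal (closure U) V cK hK (closed_closure U) oV UV)
      as (W & oW & UW & WV); exists W; auto.
  - exists U; intros; tauto.
Qed.

Definition interpolant (U V : K -> Prop) : K -> Prop :=
  proj1_sig (constructive_indefinite_description _ (interpolant_exists U V)).

Lemma interpolantP (U V : K -> Prop) : is_open V -> well_inside U V ->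
  is_open (interpolant U V) /\ well_inside U (interpolant U V) /\ well_inside (interpolant U V) V.
Proof. unfold interpolant; destruct (constructive_indefinite_description _ _); auto. Qed.

Variables U0 B : K -> Prop.
Hypothesis oU0 : is_open U0.
Hypothesis cB : is_closed B.
Hypothesis U0B : well_inside U0 (fun x => ~ B x).

(* [dyadic n k] is the open set at height k / 2^n. *)
Fixpoint dyadic (n k : nat) {struct n} : K -> Prop :=
  match n with
  | O => match k with O => U0 | 1%nat => fun x => ~ B x | _ => fun _ => True end
  | S m => if Nat.even k then dyadic m (Nat.div2 k)
           else interpolant (dyadic m (Nat.div2 k)) (dyadic m (S (Nat.div2 k)))
  end.

Lemma dyadic_double n k : dyadic (S n) (2 * k) = dyadic n k.
Proof.
  cbn [dyadic]; rewrite Nat.even_even, Nat.div2_double; reflexivity.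
Qed.

Lemma dyadic_odd n k :
  dyadic (S n) (S (2 * k)) = interpolant (dyadic n k) (dyadic n (S k)).
Proof.
  cbn [dyadic].
  replace (Nat.even (S (2 * k))) with false
    by (symmetry; rewrite Nat.even_succ, <- Nat.negb_even, Nat.even_even; reflexivity).
  rewrite Nat.div2_succ_double; reflexivity.
Qed.

Lemma dyadic_chain n : forall k, is_open (dyadic n k) /\ well_inside (dyadic n k) (dyadic n (S k)).
Proof.
  induction n as [|n IH]; intros k.
  - destruct k as [|[|k]]; simpl; split; auto; try apply open_full; intros x _; exact I.
  - destruct (Nat.Even_or_Odd k) as [[j ->]|[j ->]].
    + rewrite dyadic_odd, dyadic_double; destruct (IH j) as [o1 w1], (IH (S j)) as [o2 w2].
      destruct (interpolantP _ _ o2 w1) as (h1 & h2 & h3); auto.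
    + replace (2 * j + 1)%nat with (S (2 * j)) by lia.
      replace (S (S (2 * j)))%nat with (2 * S j)%nat by lia.
      rewrite dyadic_odd, dyadic_double; destruct (IH j) as [o1 w1], (IH (S j)) as [o2 w2].
      destruct (interpolantP _ _ o2 w1) as (h1 & h2 & h3); auto.
Qed.

Lemma dyadic_mono n k j x : (k <= j)%nat -> dyadic n k x -> dyadic n j x.
Proof.
  induction 1 as [|j h IH]; [auto|]; intros Hx.
  apply (proj2 (dyadic_chain n j)), closure_incl; auto.
Qed.

Lemma dyadic_refine m n k : dyadic (m + n) (k * 2 ^ m) = dyadic n k.
Proof.
  induction m as [|m IH]; [rewrite Nat.mul_1_r; reflexivity|].
  rewrite <- IH; replace (k * 2 ^ S m)%nat with (2 * (k * 2 ^ m))%nat by (simpl; lia).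
  apply dyadic_double.
Qed.

(** Over the common denominator 2^(m+n) both sets belong to one increasing chain. *)
Lemma dyadic_order n k m j x : dyadic n k x -> ~ dyadic m j x ->
  INR j / 2 ^ m <= INR k / 2 ^ n.
Proof.
  intros H1 H2.
  assert (h : (j * 2 ^ n < k * 2 ^ m)%nat).
  { apply Nat.nle_gt; intros h; apply H2.
    rewrite <- (dyadic_refine n m j); rewrite <- (dyadic_refine m n k) in H1.
    rewrite (Nat.add_comm n m); apply (dyadic_mono _ _ _ _ h H1). }
  apply lt_INR in h; rewrite !mult_INR, !pow_INR in h; change (INR 2) with 2 in h.
  assert (p1 : 0 < 2 ^ m) by (apply pow_lt; lra).
  assert (p2 : 0 < 2 ^ n) by (apply pow_lt; lra).
  apply (Rmult_le_reg_r (2 ^ m * 2 ^ n)); [apply Rmult_lt_0_compat; auto|].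
  replace (INR j / 2 ^ m * (2 ^ m * 2 ^ n)) with (INR j * 2 ^ n) by (field; lra).
  replace (INR k / 2 ^ n * (2 ^ m * 2 ^ n)) with (INR k * 2 ^ m) by (field; lra).
  lra.
Qed.

(** Level 0 takes the whole space from k = 2 on, so every point, including those of B, lies in some
    set of the family and heights are bounded by 2. The truncation to [0, 1] is left to
    [urysohn]. *)
Lemma dyadic_top n x : dyadic n (2 * 2 ^ n) x.
Proof.
  replace n with (n + 0)%nat at 1 by lia; rewrite dyadic_refine; simpl; auto.
Qed.

(** The value 0 is put in by hand because a point of [U0] lies in every set of the family. *)
Definition heights_below (x : K) (t : R) : Prop :=
  t = 0 \/ exists n k, ~ dyadic n k x /\ t = INR k / 2 ^ n.

Lemma height_exists x : exists t, is_lub (heights_below x) t.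
Proof.
  destruct (completeness (heights_below x)) as [t ht]; [| |exists t; exact ht].
  - exists 2; intros t [->|(n & k & h & ->)]; [lra|].
    pose proof (dyadic_order 0 2 n k x I h) as h'; simpl in h'; lra.
  - exists 0; left; auto.
Qed.

Definition height (x : K) : R :=
  proj1_sig (constructive_indefinite_description _ (height_exists x)).

Lemma height_lub x : is_lub (heights_below x) (height x).
Proof. unfold height; destruct (constructive_indefinite_description _ _); auto. Qed.

Lemma height_ge0 x : 0 <= height x.
Proof. apply (proj1 (height_lub x)); left; auto. Qed.

Lemma height_le n k x : dyadic n k x -> height x <= INR k / 2 ^ n.
Proof.
  intros H; apply (proj2 (height_lub x)); intros t [->|(m & j & h & ->)].
  - apply Rmult_le_pos; [apply pos_INR|left; apply Rinv_0_lt_compat, pow_lt; lra].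
  - apply dyadic_order with x; auto.
Qed.

Lemma height_ge n k x : ~ dyadic n k x -> INR k / 2 ^ n <= height x.
Proof. intros H; apply (proj1 (height_lub x)); right; eauto. Qed.

(** Let k be the least index with x in [dyadic n k]. On this set minus the closure of the one with
    index k - 2, heights vary by at most 2 / 2^n. The index k - 1 would not do, as x may lie in the
    closure of that set. For k < 2 the bound 0 <= height replaces the lower condition. *)
Lemma height_continuous : continuous_R height.
Proof.
  apply continuous_R_eps; intros x eps he.
  destruct (pow_lt_1_zero (1 / 2) (ltac:(rewrite Rabs_pos_eq; lra)) (eps / 2) (ltac:(lra)))
    as [n hn].
  specialize (hn n (le_n n)).
  assert (p : 0 < 2 ^ n) by (apply pow_lt; lra).
  assert (hn' : 2 / 2 ^ n < eps).
  { rewrite Rabs_pos_eq in hn by (apply pow_le; lra).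
    unfold Rdiv at 1 in hn; rewrite Rmult_1_l, pow_inv in hn; unfold Rdiv; lra. }
  assert (Hk : exists k, dyadic n k x /\ forall j, dyadic n j x -> (k <= j)%nat).
  { destruct (dec_inh_nat_subset_has_unique_least_element (fun k => dyadic n k x))
      as (k & hk & _); [intros; apply classic|exists (2 * 2 ^ n)%nat; apply dyadic_top|].
    exists k; exact hk. }
  destruct Hk as (k & Hk & kmin).
  assert (HN : exists N, is_open N /\ N x /\ forall y, N y -> INR k / 2 ^ n - 2 / 2 ^ n <= height y).
  { destruct k as [|[|k]].
    - exists (fun _ => True); repeat split; [apply open_full|]; intros y _.
      pose proof (height_ge0 y); simpl; assert (0 < 2 / 2 ^ n) by (apply Rdiv_lt_0_compat; lra); lra.
    - exists (fun _ => True); repeat split; [apply open_full|]; intros y _.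
      pose proof (height_ge0 y); simpl; assert (0 < 1 / 2 ^ n) by (apply Rdiv_lt_0_compat; lra); lra.
    - exists (fun y => ~ closure (dyadic n k) y); split; [apply closed_closure|split].
      + intros h; apply (proj2 (dyadic_chain n k)) in h; apply kmin in h; lia.
      + intros y hy; replace (INR (S (S k)) / 2 ^ n - 2 / 2 ^ n) with (INR k / 2 ^ n)
          by (rewrite !S_INR; field; lra).
        apply height_ge; intros h; apply hy, closure_incl, h. }
  destruct HN as (N & oN & Nx & HN).
  exists (fun y => N y /\ dyadic n k y); split; [|split; [auto|]].
  - apply open_inter; [auto|apply dyadic_chain].
  - intros y [Ny Dy].
    pose proof (HN y Ny); pose proof (HN x Nx).
    pose proof (height_le n k y Dy); pose proof (height_le n k x Hk).
    apply Rabs_def1; lra.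
Qed.

End Urysohn.

Lemma urysohn {K : space} (A B : K -> Prop) :
  compact K -> hausdorff K -> is_closed A -> is_closed B -> (forall x, ~ (A x /\ B x)) ->
  exists f : K -> R, continuous_R f /\ (forall x, 0 <= f x) /\
    (forall x, A x -> f x = 0) /\ (forall x, B x -> f x = 1).
Proof.
  intros cK hK cA cB dis.
  destruct (compact_hausdorff_normal A (fun x => ~ B x) cK hK cA cB) as (U0 & oU0 & AU0 & U0B).
  { intros x Ax Bx; apply (dis x); auto. }
  pose (h := height K cK hK U0 B oU0 cB U0B).
  exists (fun x => clamp 0 1 (h x)); repeat split.
  - apply continuous_R_clamp, height_continuous.
  - intros x; apply clamp_bounds; lra.
  - intros x Ax.
    assert (h1 : h x <= INR 0 / 2 ^ 0) by (apply height_le; apply AU0; auto).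
    assert (h2 : 0 <= h x) by apply height_ge0.
    simpl in h1; replace (h x) with 0 by lra; apply clamp_id; lra.
  - intros x Bx.
    assert (h1 : INR 1 / 2 ^ 0 <= h x) by (apply height_ge; simpl; auto).
    simpl in h1; unfold clamp, Rmin, Rmax.
    destruct (Rle_dec 1 (h x)); destruct (Rle_dec 0 _); lra.
Qed.

(** * Traces of points of the Stone-Cech compactification on an extension *)

Section Traces.
Context {X K : space}.
Variable e : X -> K.
Hypothesis SC : stone_cech X K e.

Let cK : compact K := proj1 SC.
Let hK : hausdorff K := proj1 (proj2 SC).
Let embK : embedding e := proj1 (proj2 (proj2 SC)).
Let densK : dense_range e := proj1 (proj2 (proj2 (proj2 SC))).

Definition in_image (p : K) : Prop := exists x, e x = p.

(** The graph of the canonical map from beta X to beta E, restricted to the points sent into E.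
    Working with traces on X avoids beta E. *)
Definition converges (E : extension X) (p : K) (y : ext_sp E) : Prop :=
  forall V, is_open V -> V y ->
    exists U : K -> Prop, is_open U /\ U p /\ forall x, U (e x) -> V (ext_emb E x).

Lemma sc_extend (f : X -> R) M : continuous_R f -> (forall x, Rabs (f x) <= M) ->
  exists g : K -> R, continuous_R g /\ forall x, g (e x) = f x.
Proof. intros cf bf; apply SC; eauto. Qed.

(** Density gives points of X near p at which k is close to k p and g is close to g y, while k and g
    agree on X. *)
Lemma converges_value (E : extension X) p y (g : ext_sp E -> R) (k : K -> R) :
  converges E p y -> continuous_R g -> continuous_R k ->
  (forall x, k (e x) = g (ext_emb E x)) -> k p = g y.
Proof.
  intros H cg ck kg; apply NNPP; intros ne.
  assert (he : Rabs (k p - g y) / 2 > 0).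
  { assert (0 < Rabs (k p - g y)) by (apply Rabs_pos_lt; lra); lra. }
  destruct (H (fun z => Rabs (g z - g y) < Rabs (k p - g y) / 2)) as (U & oU & Up & HU).
  - apply (cg (fun t => Rabs (t - g y) < Rabs (k p - g y) / 2)), R_open_ball.
  - rewrite Rminus_diag, Rabs_R0; lra.
  - destruct (continuous_R_near k ck p _ he) as (U' & oU' & U'p & HU').
    destruct (densK (fun q => U q /\ U' q)) as (x & Ux & U'x).
    + apply open_inter; auto.
    + exists p; auto.
    + specialize (HU x Ux); specialize (HU' _ U'x); rewrite kg in HU'.
      set (t := g (ext_emb E x)) in *.
      replace (k p - g y) with (- (t - k p) + (t - g y)) in * by ring.
      pose proof (Rabs_triang (- (t - k p)) (t - g y)); rewrite Rabs_Ropp in *; lra.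
Qed.

(* Complete regularity of E enters only here. *)
Lemma separating_pair (E : extension X) p y (V : ext_sp E -> Prop) :
  is_open V -> V y ->
  exists (g : ext_sp E -> R) (k : K -> R), continuous_R g /\ continuous_R k /\
    (forall x, k (e x) = g (ext_emb E x)) /\ g y = 0 /\ (forall z, g z < 1 -> V z) /\
    (k p < 1 -> exists U : K -> Prop, is_open U /\ U p /\ forall x, U (e x) -> V (ext_emb E x)).
Proof.
  intros oV Vy.
  destruct (tychonoff_clamped V y (ext_tych X E) oV Vy) as (g & cg & gy & gV & gb).
  destruct (sc_extend (fun x => g (ext_emb E x)) 1) as (k & ck & kg).
  - intros W oW; apply (proj1 (ext_embedding X E) (fun z => W (g z))); auto.
  - intros x; rewrite Rabs_pos_eq; apply gb.
  - exists g, k; repeat split; auto.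
    intros kp; exists (fun q => k q < 1); split; [|split; [auto|]].
    + apply (ck (fun t => t < 1)), R_open_lt.
    + intros x; rewrite kg; auto.
Qed.

Lemma not_converges_pair (E : extension X) p y : ~ converges E p y ->
  exists (g : ext_sp E -> R) (k : K -> R), continuous_R g /\ continuous_R k /\
    (forall x, k (e x) = g (ext_emb E x)) /\ g y = 0 /\ 1 <= k p.
Proof.
  intros H; apply not_all_ex_not in H; destruct H as [V H].
  apply imply_to_and in H; destruct H as [oV H].
  apply imply_to_and in H; destruct H as [Vy H].
  destruct (separating_pair E p y V oV Vy) as (g & k & cg & ck & kg & gy & _ & hk).
  exists g, k; repeat split; auto; apply Rnot_lt_le; auto.
Qed.

(** The level 1/2 separates the values of g near y from those of k near p. By [converges_value] the
    functions agree along every convergent pair, so the separation holds for all limits and not only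
    on X. *)
Lemma not_converges_separated (E : extension X) p y : ~ converges E p y ->
  exists (V : ext_sp E -> Prop) (U : K -> Prop), is_open V /\ is_open U /\ V y /\ U p /\
    (forall q z, converges E q z -> V z -> ~ U q) /\
    (forall x, V (ext_emb E x) -> ~ U (e x)).
Proof.
  intros H; destruct (not_converges_pair E p y H) as (g & k & cg & ck & kg & gy & kp).
  exists (fun z => g z < 1 / 2), (fun q => 1 / 2 < k q); repeat split.
  - apply (cg (fun t => t < 1 / 2)), R_open_lt.
  - apply (ck (fun t => 1 / 2 < t)), R_open_gt.
  - lra.
  - lra.
  - intros q z Hq Vz Uq; rewrite (converges_value E q z g k Hq cg ck kg) in Uq; lra.
  - intros x Vx Ux; rewrite kg in Ux; lra.
Qed.

Lemma converges_unique (E : extension X) p y y' :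
  converges E p y -> converges E p y' -> y = y'.
Proof.
  intros H H'; apply NNPP; intros ne.
  destruct (proj1 (ext_tych X E) y y' ne) as (V & V' & oV & oV' & Vy & Vy' & dis).
  destruct (H V oV Vy) as (U & oU & Up & HU).
  destruct (H' V' oV' Vy') as (U' & oU' & Up' & HU').
  destruct (densK (fun q => U q /\ U' q)) as (x & Ux & U'x).
  - apply open_inter; auto.
  - exists p; auto.
  - apply (dis (ext_emb E x)); auto.
Qed.

Lemma converges_image (E : extension X) x : converges E (e x) (ext_emb E x).
Proof.
  intros V oV Vx.
  destruct (proj2 (proj2 embK) _ (proj1 (ext_embedding X E) V oV)) as (U & oU & HU).
  exists U; split; [auto|split]; intros; apply HU; auto.
Qed.

(** Since X is embedded in E, a neighbourhood of e x disjoint from one of p has the same trace on X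
    as an open set of E. Convergence puts all points of X near p into that trace, which density
    makes absurd. *)
Lemma converges_to_image (E : extension X) p x : converges E p (ext_emb E x) -> p = e x.
Proof.
  intros H; apply NNPP; intros ne.
  destruct (hK p (e x) ne) as (U & U' & oU & oU' & Up & U'x & dis).
  destruct (proj2 (proj2 (ext_embedding X E)) _ (proj1 embK U' oU')) as (V & oV & HV).
  destruct (H V oV) as (W & oW & Wp & HW); [apply HV; auto|].
  destruct (densK (fun q => U q /\ W q)) as (z & Uz & Wz).
  - apply open_inter; auto.
  - exists p; auto.
  - apply (dis (e z)); split; [auto|]; apply HV, HW; auto.
Qed.

(** The traces on X of the neighbourhoods of y form a filter base in K; each of its cluster points
    converges to y. *)
Lemma converges_surjective (E : extension X) y : exists p, converges E p y.
Proof.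
  destruct (compact_cluster_point
    (fun b => exists V, is_open V /\ V y /\ b = (fun q => exists x, e x = q /\ V (ext_emb E x)))
    cK) as (p & Hp).
  - exists (fun q => exists x, e x = q /\ True), (fun _ => True); repeat split; apply open_full.
  - intros b (V & oV & Vy & ->).
    destruct (ext_dense X E V oV) as [x Vx]; [eauto|]; exists (e x), x; auto.
  - intros b b' (V & oV & Vy & ->) (V' & oV' & Vy' & ->).
    exists (fun q => exists x, e x = q /\ (V (ext_emb E x) /\ V' (ext_emb E x))); split.
    + exists (fun z => V z /\ V' z); split; [apply open_inter; auto|auto].
    + intros q (x & <- & h & h'); split; exists x; auto.
  - exists p; apply NNPP; intros H.
    destruct (not_converges_separated E p y H) as (V & U & oV & oU & Vy & Up & _ & dis).
    destruct (Hp (fun q => exists x, e x = q /\ V (ext_emb E x))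
      (ex_intro _ V (conj oV (conj Vy eq_refl))) U oU Up) as (q & Uq & x & <- & Vx).
    apply (dis x); auto.
Qed.

Lemma converges_continuous (E : extension X) p y (V : ext_sp E -> Prop) :
  converges E p y -> is_open V -> V y ->
  exists U : K -> Prop, is_open U /\ U p /\ forall q z, converges E q z -> U q -> V z.
Proof.
  intros H oV Vy.
  destruct (separating_pair E p y V oV Vy) as (g & k & cg & ck & kg & gy & gV & _).
  exists (fun q => k q < 1); split; [apply (ck (fun t => t < 1)), R_open_lt|split].
  - rewrite (converges_value E p y g k H cg ck kg); lra.
  - intros q z Hq Uq; apply gV; rewrite <- (converges_value E q z g k Hq cg ck kg); auto.
Qed.

(** The limit map is closed: the compact complement of W has a finite cover by open sets separated
    from neighbourhoods of y. Together with [converges_continuous] this makes E a quotient of its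
    domain in K. *)
Lemma converges_closed_map (E : extension X) y (W : K -> Prop) :
  is_open W -> (forall p, converges E p y -> W p) ->
  exists V : ext_sp E -> Prop, is_open V /\ V y /\ forall p z, converges E p z -> V z -> W p.
Proof.
  intros oW HW.
  destruct (compact_set_uniform (fun p => ~ W p) y
    (fun (U : K -> Prop) V => forall p z, converges E p z -> V z -> ~ U p))
    as (V & oV & Vy & l & lcov & lP).
  - apply closed_compact_set; [auto|apply closed_not; auto].
  - intros U V V' H h p z Hp Vz; apply (H p z); auto.
  - intros p nW.
    destruct (not_converges_separated E p y (fun h => nW (HW p h)))
      as (V & U & oV & oU & Vy & Up & dis & _).
    exists U, V; auto 10.
  - exists V; split; [auto|split; [auto|]]; intros p z Hp Vz; apply NNPP; intros nW.
    destruct (lcov p nW) as (U & iU & Up); apply (proj2 (lP U iU) p z); auto.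
Qed.

Definition limit_domain (E : extension X) (p : K) : Prop :=
  (exists y, converges E p y) /\ ~ in_image p.

(** At a point p outside X without a limit, compactness of the remainder gives one neighbourhood of
    p in which no point has a limit in the remainder. Limits in X are excluded by
    [converges_to_image]. *)
Lemma limit_domain_closed (E : extension X) :
  is_open in_image -> compact_set (remainder E) -> is_closed (limit_domain E).
Proof.
  intros oX cR; apply open_local; intros p np.
  destruct (classic (in_image p)) as [Xp|nX].
  - exists in_image; split; [auto|split; [auto|]]; intros q Xq [_ h]; auto.
  - destruct (compact_set_uniform (remainder E) p
      (fun V (U : K -> Prop) => forall q z, converges E q z -> V z -> ~ U q) cR)
      as (U & oU & Up & l & lcov & lP).
    + intros V U U' H h q z Hq Vz Uq; apply (H q z); auto.
    + intros y _.
      destruct (not_converges_separated E p y) as (V & U & oV & oU & Vy & Up & dis & _).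
      { intros h; apply np; split; eauto. }
      exists V, U; auto 10.
    + exists U; split; [auto|split; [auto|]]; intros q Uq [[z Hz] nq].
      destruct (lcov z) as (V & iV & Vz).
      { intros [x <-]; apply nq; exists x; symmetry; eapply converges_to_image; eauto. }
      apply (proj2 (lP V iV) q z); auto.
Qed.

(** The coordinates of a closed embedding of E into a power of R restrict to continuous functions on
    X, so they extend to p. Their values at p form a tuple that lies in the image of E, for
    otherwise a basic box around it misses the image, although points of X near p fall into the
    box. *)
Lemma upsilon_converges (E : extension X) p :
  realcompact (ext_sp E) -> in_upsilon e p -> exists y, converges E p y.
Proof.
  intros (I & h & hc & hi & ho & hcl) Hp.
  assert (Hi : forall i, exists g : K -> R,
    rel_continuous_R (fun q => (exists x, e x = q) \/ q = p) g /\
    forall x, g (e x) = h (ext_emb E x) i).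
  { intros i; apply Hp; intros V oV.
    apply (proj1 (ext_embedding X E) (fun z => V (h z i))).
    apply (hc (fun y => V (y i))); intros y Vy; destruct (oV _ Vy) as (eps & he & H).
    exists (i :: nil), eps; split; [auto|]; intros y' Hy'; apply H, Hy'; left; auto. }
  pose (g := fun i => proj1_sig (constructive_indefinite_description _ (Hi i))).
  assert (gc : forall i, rel_continuous_R (fun q => (exists x, e x = q) \/ q = p) (g i))
    by (intros i; apply (proj2_sig (constructive_indefinite_description _ (Hi i)))).
  assert (ge : forall i x, g i (e x) = h (ext_emb E x) i)
    by (intros i; apply (proj2_sig (constructive_indefinite_description _ (Hi i)))).
  assert (near : forall (l : list I) eps, eps > 0 -> exists U : K -> Prop, is_open U /\ U p /\
    forall x, U (e x) -> forall i, In i l -> Rabs (h (ext_emb E x) i - g i p) < eps).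
  { intros l eps he; induction l as [|i l (U & oU & Up & HU)].
    - exists (fun _ => True); repeat split; [apply open_full|]; intros x _ i [].
    - destruct (rel_continuous_R_near _ _ (gc i) p eps (or_intror eq_refl) he)
        as (U' & oU' & U'p & HU').
      exists (fun q => U q /\ U' q); split; [apply open_inter; auto|split; [auto|]].
      intros x [Ux U'x] j [<-|ij]; [rewrite <- ge|]; auto.
      apply HU'; eauto. }
  destruct (classic (exists y, h y = fun i => g i p)) as [[y hy]|ny].
  - exists y; intros V oV Vy; destruct (ho V oV) as (W & oW & HW).
    destruct (oW (h y)) as (l & eps & he & H); [apply HW; auto|].
    destruct (near l eps he) as (U & oU & Up & HU); exists U; split; [auto|split; [auto|]].
    intros x Ux; apply HW, H; intros i ii; rewrite hy; auto.
  - destruct (hcl (fun i => g i p) ny) as (l & eps & he & H).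
    destruct (near l eps he) as (U & oU & Up & HU).
    destruct (densK U oU (ex_intro _ p Up)) as [x Ux].
    exfalso; apply (H (h (ext_emb E x))); eauto.
Qed.

(** On the diagonal this says that p has a limit, so the domain can be read off the relation. *)
Definition same_limit (E : extension X) (p q : K) : Prop :=
  exists y, converges E p y /\ converges E q y.

Lemma same_limit_sym E p q : same_limit E p q -> same_limit E q p.
Proof. intros (y & h1 & h2); exists y; auto. Qed.

Lemma same_limit_left E p q : same_limit E p q -> same_limit E p p.
Proof. intros (y & h1 & h2); exists y; auto. Qed.

Lemma same_limit_right E p q : same_limit E p q -> same_limit E q q.
Proof. intros (y & h1 & h2); exists y; auto. Qed.

Lemma same_limit_image E x : same_limit E (e x) (e x).
Proof. exists (ext_emb E x); split; apply converges_image. Qed.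

Lemma same_limit_image_eq E x q : same_limit E (e x) q -> q = e x.
Proof.
  intros (y & h1 & h2).
  rewrite (converges_unique E _ _ _ h1 (converges_image E x)) in h2.
  apply converges_to_image in h2; auto.
Qed.

(** A continuous map fixing X carries limits to limits. Conversely, containment makes the limit map
    of E' constant on the fibres of that of E, hence a function of it; this function is continuous
    because the limit map of E is closed. *)
Lemma ext_le_same_limit (E E' : extension X) :
  ext_le E' E <-> forall p q, same_limit E p q -> same_limit E' p q.
Proof.
  split.
  - intros (psi & cpsi & hpsi).
    assert (H : forall p y, converges E p y -> converges E' p (psi y)).
    { intros p y Hp V oV Vy; destruct (Hp _ (cpsi V oV) Vy) as (U & oU & Up & HU).
      exists U; split; [auto|split; [auto|]]; intros x Ux; rewrite <- hpsi; auto. }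
    intros p q (y & h1 & h2); exists (psi y); auto.
  - intros H.
    assert (Hy : forall y, exists z, forall p, converges E p y -> converges E' p z).
    { intros y; destruct (converges_surjective E y) as [p Hp].
      destruct (H p p) as (z & Hz & _); [exists y; auto|].
      exists z; intros q Hq; destruct (H p q) as (z' & h1 & h2); [exists y; auto|].
      rewrite (converges_unique E' p z z'); auto. }
    pose (psi := fun y => proj1_sig (constructive_indefinite_description _ (Hy y))).
    assert (Hpsi : forall y p, converges E p y -> converges E' p (psi y))
      by (intros y; apply (proj2_sig (constructive_indefinite_description _ (Hy y)))).
    exists psi; split.
    + intros V oV; apply open_local; intros y Vy.
      destruct (converges_closed_map E y
        (fun p => exists U : K -> Prop, (is_open U /\ forall q z, converges E' q z -> U q -> V z) /\ U p))
        as (N & oN & Ny & HN).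
      * apply (open_union K (fun U => is_open U /\ forall q z, converges E' q z -> U q -> V z)).
        intros U [oU _]; auto.
      * intros p Hp; apply Hpsi in Hp.
        destruct (converges_continuous E' p (psi y) V Hp oV Vy) as (U & oU & Up & HU).
        exists U; auto.
      * exists N; split; [auto|split; [auto|]]; intros z Nz.
        destruct (converges_surjective E z) as [p Hp].
        destruct (HN p z Hp Nz) as (U & (_ & HU) & Up).
        apply (HU p); auto.
    + intros x; apply (converges_unique E' (e x)); [apply Hpsi|]; apply converges_image.
Qed.

(** A compact neighbourhood C of x has closed image in K. If W is open with trace inside C, the part
    of W off that image is open and contains no point of X, so it is empty by density. *)
Lemma image_open : locally_compact X -> is_open in_image.
Proof.
  intros lc; apply open_local; intros p [x <-].
  destruct (lc x) as (U & C & oU & Ux & cC & UC).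
  destruct (proj2 (proj2 embK) U oU) as (W & oW & HW).
  exists W; split; [auto|split; [apply HW; auto|]]; intros q Wq.
  apply NNPP; intros nq.
  assert (cD : is_closed (fun p => exists x, C x /\ e x = p)).
  { apply compact_set_closed; [auto|]; intros F oF cov.
    destruct (cC (fun V => exists V', F V' /\ V = fun x => V' (e x))) as (l & lF & lcov).
    - intros V (V' & FV' & ->); apply (proj1 embK); auto.
    - intros z Cz; destruct (cov (e z)) as (V & FV & Vz); [eauto|].
      exists (fun x => V (e x)); eauto.
    - destruct (list_witnesses l _ lF) as (l' & h1 & h2); exists l'; split.
      { intros V iV; destruct (h1 V iV) as (_ & _ & FV & _); auto. }
      intros p0 (z & Cz & <-); destruct (lcov z Cz) as (V & iV & Vz).
      destruct (h2 V iV) as (V' & iV' & _ & ->); eauto. }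
  destruct (densK (fun p => W p /\ ~ exists x, C x /\ e x = p)) as (z & Wz & nz).
  - apply open_inter; auto.
  - exists q; split; [auto|]; intros (z & _ & <-); apply nq; exists z; auto.
  - apply nz; exists z; split; [apply UC, HW; auto|auto].
Qed.

End Traces.

(** * Extensions obtained from decompositions of closed sets *)

Lemma inv_1_abs_lipschitz s t : Rabs (/ (1 + Rabs s) - / (1 + Rabs t)) <= Rabs (s - t).
Proof.
  pose proof (Rabs_pos s) as hs; pose proof (Rabs_pos t) as ht.
  rewrite (Rabs_minus_sym s t).
  apply Rle_trans with (Rabs (Rabs t - Rabs s)); [|apply Rabs_triang_inv2].
  set (a := Rabs s) in *; set (b := Rabs t) in *.
  replace (/ (1 + a) - / (1 + b)) with ((b - a) * (/ (1 + a) * / (1 + b))) by (field; lra).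
  rewrite Rabs_mult, (Rabs_pos_eq (/ (1 + a) * / (1 + b))).
  - rewrite <- (Rmult_1_r (Rabs (b - a))) at 2.
    apply Rmult_le_compat_l; [apply Rabs_pos|].
    rewrite <- Rinv_mult, <- Rinv_1; apply Rinv_le_contravar; nra.
  - apply Rmult_le_pos; left; apply Rinv_0_lt_compat; lra.
Qed.

Section Realization.
Context {X K : space}.
Variable e : X -> K.
Hypothesis SC : stone_cech X K e.

Let cK : compact K := proj1 SC.
Let hK : hausdorff K := proj1 (proj2 SC).
Let embK : embedding e := proj1 (proj2 (proj2 SC)).
Let densK : dense_range e := proj1 (proj2 (proj2 (proj2 SC))).

(* If the extension k of 1 / (1 + |f|) does not vanish at p then f is bounded near p, so f agrees
   near p with a truncation of f, which extends to p. *)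
Lemma not_upsilon_vanishing p : ~ in_upsilon e p ->
  exists k : K -> R, continuous_R k /\ k p = 0 /\ (forall x, 0 < k (e x)) /\ forall q, 0 <= k q.
Proof.
  intros H; apply not_all_ex_not in H; destruct H as [f H].
  apply imply_to_and in H; destruct H as [cf H].
  assert (pos : forall t, 0 < / (1 + Rabs t) <= 1).
  { intros t; pose proof (Rabs_pos t); split; [apply Rinv_0_lt_compat; lra|].
    rewrite <- Rinv_1 at 2; apply Rinv_le_contravar; lra. }
  destruct (sc_extend e SC (fun x => / (1 + Rabs (f x))) 1) as (k & ck & kf).
  { apply (continuous_R_lipschitz (fun t => / (1 + Rabs t))); [apply inv_1_abs_lipschitz|auto]. }
  { intros x; destruct (pos (f x)); rewrite Rabs_pos_eq; lra. }
  assert (kb : forall q, 0 <= k q).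
  { intros q; apply Rnot_lt_le; intros h.
    destruct (densK (fun q => k q < 0)) as [x hx]; [|eauto|].
    - apply (ck (fun t => t < 0)), R_open_lt.
    - rewrite kf in hx; destruct (pos (f x)); lra. }
  exists k; repeat split; auto.
  - apply NNPP; intros kp; apply H.
    assert (kp' : 0 < k p) by (pose proof (kb p); lra).
    (* Where k exceeds k p / 2 on X, 1 + |f| is below 2 / k p, so truncation at M leaves f unchanged
       there. *)
    set (M := 2 / k p).
    destruct (sc_extend e SC (fun x => clamp (- M) M (f x)) M) as (g & cg & gf).
    { apply continuous_R_clamp; auto. }
    { assert (0 < M) by (apply Rdiv_lt_0_compat; lra).
      intros x; apply Rabs_le, clamp_bounds; lra. }
    assert (near : forall x, k p / 2 < k (e x) -> g (e x) = f x).
    { intros x hx; rewrite gf; apply clamp_id.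
      rewrite kf in hx.
      assert (h : Rabs (f x) <= M).
      { pose proof (Rabs_pos (f x)).
        apply Rinv_lt_contravar in hx.
        - rewrite Rinv_inv, Rinv_div in hx; fold M in hx; lra.
        - apply Rmult_lt_0_compat; [lra|apply pos]. }
      unfold Rabs in h; destruct (Rcase_abs (f x)); lra. }
    pose (F := fun q => match excluded_middle_informative (exists x, e x = q) with
      | left h => f (proj1_sig (constructive_indefinite_description _ h))
      | right _ => g q end).
    assert (Fe : forall x, F (e x) = f x).
    { intros x; unfold F; destruct (excluded_middle_informative _) as [h|h];
        [|exfalso; apply h; exists x; auto].
      destruct (constructive_indefinite_description _ h) as [z hz]; simpl.
      f_equal; apply embK; auto. }
    exists F; split; [|exact Fe].
    apply rel_continuous_R_eps; intros q eps Sq he.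
    destruct (classic (exists x, e x = q)) as [[x <-]|nq].
    + destruct (continuous_R_near f cf x eps he) as (U & oU & Ux & HU).
      destruct (proj2 (proj2 embK) U oU) as (W & oW & HW).
      (* The point p belongs to the set on which continuity is claimed, so it has to be removed from
         the neighbourhood of any other point of X. *)
      destruct (classic (e x = p)) as [xp|xp].
      * exists W; split; [auto|split; [apply HW; auto|]].
        intros r [[z <-]| ->] Wr; [|rewrite <- xp in Wr |- *];
          rewrite !Fe; apply HU, HW; auto.
      * exists (fun r => W r /\ r <> p); split; [|split; [split; [apply HW|]; auto|]].
        -- apply open_inter; [auto|apply closed_point; auto].
        -- intros r [[z <-]| ->] [Wr nr]; [|contradiction].
           rewrite !Fe; apply HU, HW; auto.
    + destruct Sq as [h| ->]; [contradiction|].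
      assert (Fp : F p = g p).
      { unfold F; destruct (excluded_middle_informative _); [contradiction|auto]. }
      destruct (continuous_R_near g cg p eps he) as (U & oU & Up & HU).
      exists (fun r => U r /\ k p / 2 < k r); split; [|split; [split; [auto|lra]|]].
      * apply open_inter; [auto|apply (ck (fun t => k p / 2 < t)), R_open_gt].
      * intros r [[z <-]| ->] [Ur kr].
        -- rewrite Fe, Fp, <- near; auto.
        -- rewrite Rminus_diag, Rabs_R0; lra.
  - intros x; rewrite kf; apply pos.
Qed.

Variable C : K -> Prop.
Hypothesis oX : is_open (in_image e).
Hypothesis cC : is_closed C.
Hypothesis CX : forall p, C p -> ~ in_image e p.
Hypothesis Cups : forall p, in_upsilon e p -> in_image e p \/ C p.

(* The retraction pi encodes a decomposition of C by choosing a point in each class. *)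
Variable pi : K -> K.
Hypothesis pi_idem : forall p, pi (pi p) = pi p.
Hypothesis pi_C : forall p, C p -> C (pi p).
Hypothesis pi_out : forall p, ~ C p -> pi p = p.
(** A class is separated from the complement of an open set around it by a function that is constant
    on classes, and therefore descends to the quotient. W itself need not be a union of classes. *)
Hypothesis pi_sep : forall z (W : K -> Prop), is_open W -> (forall p, pi p = pi z -> W p) ->
  exists g : K -> R, continuous_R g /\ g z = 0 /\ (forall p, ~ W p -> g p = 1) /\
    forall p, g (pi p) = g p.

Definition adjoined (p : K) : Prop := in_image e p \/ C p.

Lemma pi_image x : pi (e x) = e x.
Proof. apply pi_out; intros h; apply (CX _ h); exists x; auto. Qed.

Lemma pi_adjoined p : adjoined p -> adjoined (pi p).
Proof.
  intros [[x <-]|Cp]; [rewrite pi_image; left; exists x; auto|right; auto].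
Qed.

Lemma adjoined_pi p : adjoined (pi p) -> adjoined p.
Proof.
  intros h; destruct (classic (C p)) as [Cp|nC]; [right; auto|].
  rewrite (pi_out p nC) in h; auto.
Qed.

(** Each class is represented by its fixed point under [pi], so equality in the quotient is equality
    in K. *)
Definition quotient_pt := { z : K | adjoined z /\ pi z = z }.

Definition quotient_class (p : K) (h : adjoined p) : quotient_pt :=
  exist _ (pi p) (conj (pi_adjoined p h) (pi_idem p)).

Definition saturated_trace (V : quotient_pt -> Prop) (W : K -> Prop) : Prop :=
  forall p (h : adjoined p), V (quotient_class p h) <-> W p.

Definition quotient_open (V : quotient_pt -> Prop) : Prop :=
  exists W, is_open W /\ saturated_trace V W.

Definition quotient_space : space.
Proof.
  refine (Space quotient_pt quotient_open _ _ _ _).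
  - intros A B AB (W & oW & HW); exists W; split; [auto|].
    intros p h; rewrite <- AB; apply HW.
  - exists (fun _ => True); split; [apply open_full|]; intros p h; tauto.
  - intros A B (W & oW & HW) (W' & oW' & HW'); exists (fun p => W p /\ W' p).
    split; [apply open_inter; auto|]; intros p h.
    rewrite (HW p h), (HW' p h); tauto.
  - intros F HF.
    exists (fun p => exists W, (is_open W /\ exists A, F A /\ saturated_trace A W) /\ W p); split.
    + apply (open_union K (fun W => is_open W /\ exists A, F A /\ saturated_trace A W)).
      intros W [oW _]; auto.
    + intros p h; split.
      * intros (A & FA & Ap); destruct (HF A FA) as (W & oW & HW).
        exists W; split; [eauto|apply (HW p h); auto].
      * intros (W & (oW & A & FA & HW) & Wp); exists A; split; [auto|apply (HW p h); auto].
Defined.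

Lemma quotient_class_val (q : quotient_pt) : quotient_class (proj1_sig q) (proj1 (proj2_sig q)) = q.
Proof. apply eq_sig_hprop; [intros; apply proof_irrelevance|apply (proj2_sig q)]. Qed.

Lemma quotient_eq (q q' : quotient_pt) : proj1_sig q = proj1_sig q' -> q = q'.
Proof. apply eq_sig_hprop; intros; apply proof_irrelevance. Qed.

Lemma saturated_trace_val V W (q : quotient_pt) :
  saturated_trace V W -> (V q <-> W (proj1_sig q)).
Proof. intros H; rewrite <- (quotient_class_val q) at 1; apply H. Qed.

Definition quotient_emb (x : X) : quotient_space :=
  exist _ (e x) (conj (or_introl (ex_intro _ x eq_refl)) (pi_image x)).

Lemma quotient_function (k : K -> R) :
  rel_continuous_R adjoined k -> (forall p, adjoined p -> k (pi p) = k p) ->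
  continuous_R (fun q : quotient_space => k (proj1_sig q)).
Proof.
  intros ck kpi V oV; destruct (ck V oV) as (U & oU & HU).
  exists U; split; [auto|]; intros p h; simpl; rewrite kpi; auto.
Qed.

Lemma quotient_sep (q : quotient_pt) (W : K -> Prop) :
  is_open W -> (forall p, pi p = proj1_sig q -> W p) ->
  exists g : K -> R, continuous_R g /\ g (proj1_sig q) = 0 /\ (forall p, ~ W p -> g p = 1) /\
    continuous_R (fun q : quotient_space => g (proj1_sig q)).
Proof.
  intros oW HW; destruct (pi_sep (proj1_sig q) W oW) as (g & cg & g0 & g1 & gpi).
  - rewrite (proj2 (proj2_sig q)); auto.
  - exists g; repeat split; auto; apply quotient_function; auto; apply continuous_R_rel; auto.
Qed.

Lemma quotient_tychonoff : tychonoff quotient_space.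
Proof.
  split.
  - intros q q' ne.
    destruct (quotient_sep q (fun p => p <> proj1_sig q')) as (g & cg & g0 & g1 & cq).
    + apply closed_point; auto.
    + intros p hp hp'; apply ne, quotient_eq; rewrite <- hp, hp'; apply (proj2_sig q').
    + exists (fun r => g (proj1_sig r) < 1 / 2), (fun r => 1 / 2 < g (proj1_sig r)).
      split; [apply (cq (fun t => t < 1 / 2)), R_open_lt|].
      split; [apply (cq (fun t => 1 / 2 < t)), R_open_gt|].
      rewrite (g1 (proj1_sig q')) by tauto.
      split; [lra|split; [lra|intros z; lra]].
  - intros D q (W & oW & HW) nD.
    destruct (quotient_sep q W oW) as (g & cg & g0 & g1 & cq).
    + intros p hp.
      assert (h : adjoined p) by (apply adjoined_pi; rewrite hp; apply (proj2_sig q)).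
      apply (HW p h); replace (quotient_class p h) with q; auto.
      apply quotient_eq; auto.
    + exists (fun r => g (proj1_sig r)); split; [auto|split; [auto|]].
      intros r Dr; apply g1; intros Wr.
      apply (saturated_trace_val _ _ r HW) in Wr; auto.
Qed.

Lemma quotient_embedding : embedding quotient_emb.
Proof.
  split; [|split].
  - intros V (W & oW & HW).
    apply open_ext with (fun x => W (e x)); [|apply (proj1 embK); auto].
    intros x; symmetry; apply (saturated_trace_val V W (quotient_emb x) HW).
  - intros x y h; apply embK; apply (f_equal (@proj1_sig _ _)) in h; exact h.
  - intros U oU; destruct (proj2 (proj2 embK) U oU) as (W & oW & HW).
    (* Cutting W down to the open set X makes its trace a union of classes, because [pi] fixes X and
       maps C into C. *)
    exists (fun q => W (proj1_sig q) /\ in_image e (proj1_sig q)); split.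
    + exists (fun p => W p /\ in_image e p); split; [apply open_inter; auto|].
      intros p [[x <-]|Cp]; simpl; [rewrite pi_image; tauto|].
      split; intros [_ h]; exfalso; [apply (CX (pi p))|apply (CX p)]; auto.
    + intros x; simpl; rewrite HW; split; [intros; split; [auto|exists x; auto]|tauto].
Qed.

Lemma quotient_dense : dense_range quotient_emb.
Proof.
  intros V (W & oW & HW) [q Vq].
  destruct (densK W oW) as [x Wx].
  - exists (proj1_sig q); apply (saturated_trace_val V W q HW); auto.
  - exists x; apply (saturated_trace_val V W (quotient_emb x) HW); auto.
Qed.

Definition quotient_extension : extension X :=
  Extension X quotient_space quotient_emb quotient_tychonoff quotient_embedding quotient_dense.

Lemma quotient_remainder_compact : compact_set (remainder quotient_extension).
Proof.
  intros F oF cov.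
  destruct (closed_compact_set C cK cC
    (fun W => is_open W /\ exists V, F V /\ saturated_trace V W)) as (l & lF & lcov).
  - intros W [oW _]; auto.
  - intros p Cp; destruct (cov (quotient_class p (or_intror Cp))) as (V & FV & Vp).
    + intros [x hx]; apply (f_equal (@proj1_sig _ _)) in hx; simpl in hx.
      apply (CX (pi p)); [auto|exists x; auto].
    + destruct (oF V FV) as (W & oW & HW); exists W; split; [eauto|].
      apply (HW p (or_intror Cp)); auto.
  - destruct (list_witnesses l (fun W V => F V /\ saturated_trace V W)) as (l' & h1 & h2).
    { intros W iW; apply lF; auto. }
    exists l'; split.
    + intros V iV; destruct (h1 V iV) as (W & _ & FV & _); auto.
    + intros q Rq; destruct (proj1 (proj2_sig q)) as [[x hx]|Cq].
      { exfalso; apply Rq; exists x; apply quotient_eq; exact hx. }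
      destruct (lcov _ Cq) as (W & iW & Wq); destruct (h2 W iW) as (V & iV & _ & HV).
      exists V; split; [auto|]; apply (saturated_trace_val V W q HV); auto.
Qed.

(* 1 / k is a continuous function on the quotient that tends to infinity at p. *)
Lemma quotient_pole p : ~ adjoined p ->
  exists k : K -> R, continuous_R k /\ k p = 0 /\ (forall q, adjoined q -> 0 < k q) /\
    (forall q, adjoined q -> k (pi q) = k q) /\ continuous_R (fun q : quotient_space => / k (proj1_sig q)).
Proof.
  intros np.
  destruct (not_upsilon_vanishing p) as (k & ck & kp & kX & kb).
  { intros h; apply np, Cups; auto. }
  destruct (urysohn (fun q => q = p) C cK hK (closed_point p hK) cC) as (c & cc & cb & c0 & c1).
  { intros q [-> Cp]; apply np; right; auto. }
  (* Both summands vanish at p; k keeps m positive on X, and c makes m equal to 1 on C. *)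
  pose (m := fun q => clamp 0 1 (k q + c q)).
  assert (cm : continuous_R m) by (apply continuous_R_clamp, continuous_R_plus; auto).
  assert (mC : forall q, C q -> m q = 1).
  { intros q Cq; unfold m, clamp; rewrite (c1 q Cq); specialize (kb q).
    rewrite Rmin_left, Rmax_right; lra. }
  assert (mpos : forall q, adjoined q -> 0 < m q).
  { intros q [[x <-]|Cq]; [|rewrite mC; auto; lra].
    unfold m, clamp; specialize (kX x); specialize (cb (e x)).
    unfold Rmin; destruct (Rle_dec _ _); rewrite Rmax_right; lra. }
  assert (mpi : forall q, adjoined q -> m (pi q) = m q).
  { intros q [[x <-]|Cq]; [rewrite pi_image; auto|rewrite !mC; auto]. }
  exists m; repeat split; auto.
  - unfold m; rewrite kp, c0 by auto; rewrite Rplus_0_r; apply clamp_id; lra.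
  - apply (quotient_function (fun q => / m q)).
    + apply rel_continuous_R_eps; intros q eps Aq he; specialize (mpos q Aq) as mq.
      (* The first bound gives m r > m q / 2; the second then controls the quotient of |m r - m q|
         by m r times m q. *)
      assert (hd : Rmin (m q / 2) (eps * (m q * m q) / 2) > 0).
      { apply Rmin_pos; [lra|].
        apply Rdiv_lt_0_compat; [|lra]; repeat apply Rmult_lt_0_compat; lra. }
      destruct (continuous_R_near m cm q _ hd) as (U & oU & Uq & HU).
      exists U; split; [auto|split; [auto|]]; intros r Ar Ur; specialize (HU r Ur).
      pose proof (mpos r Ar) as mr.
      pose proof (Rmin_l (m q / 2) (eps * (m q * m q) / 2)).
      pose proof (Rmin_r (m q / 2) (eps * (m q * m q) / 2)).
      assert (hr : m q / 2 < m r) by (unfold Rabs in HU; destruct (Rcase_abs _); lra).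
      replace (/ m r - / m q) with (- (m r - m q) / (m r * m q)) by (field; lra).
      assert (pr : 0 < m r * m q) by (apply Rmult_lt_0_compat; lra).
      unfold Rdiv; rewrite Rabs_mult, Rabs_Ropp, (Rabs_pos_eq (/ _))
        by (left; apply Rinv_0_lt_compat; auto).
      apply (Rmult_lt_reg_r (m r * m q)); [auto|].
      rewrite Rmult_assoc, Rinv_l, Rmult_1_r by lra.
      apply Rlt_le_trans with (eps * (m q * m q) / 2); [lra|].
      assert (m q * (m q / 2) <= m q * m r) by (apply Rmult_le_compat_l; lra).
      assert (eps * (m q * (m q / 2)) <= eps * (m q * m r)) by (apply Rmult_le_compat_l; lra).
      lra.
    + intros q Aq; rewrite mpi; auto.
Qed.

(** All continuous real functions serve as coordinates. If y is in the closure of the image, the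
    sets of points with finitely many coordinates close to those of y have a cluster point p in K.
    If p is in X u C, continuity makes y the image of its class; otherwise the function of
    [quotient_pole] is unbounded near p, against the finite coordinate of y. *)
Lemma quotient_realcompact : realcompact quotient_space.
Proof.
  exists { f : quotient_space -> R | continuous_R f }, (fun q f => proj1_sig f q).
  split; [|split; [|split]].
  - intros V oV; apply open_local; intros q Vq.
    destruct (oV _ Vq) as (l & eps & he & H).
    assert (HU : exists U : quotient_space -> Prop, is_open U /\ U q /\ forall r, U r ->
      forall f, In f l -> Rabs (proj1_sig f r - proj1_sig f q) < eps).
    { clear H; induction l as [|f l (U & oU & Uq & HU)].
      - exists (fun _ => True); repeat split; [apply open_full|]; intros r _ f [].
      - destruct (continuous_R_near _ (proj2_sig f) q eps he) as (U' & oU' & U'q & HU').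
        exists (fun r => U r /\ U' r); split; [apply open_inter; auto|split; [auto|]].
        intros r [Ur U'r] f' [<-|i]; auto. }
    destruct HU as (U & oU & Uq & HU); exists U; split; [auto|split; [auto|]].
    intros r Ur; apply H; auto.
  - intros q q' h; apply NNPP; intros ne.
    destruct (tychonoff_clamped (fun r => r <> q') q quotient_tychonoff) as (f & cf & f0 & f1 & _).
    + apply closed_point, quotient_tychonoff.
    + auto.
    + apply (f_equal (fun F => F (exist _ f cf))) in h; simpl in h.
      apply (f1 q'); [lra|auto].
  - intros U oU.
    exists (fun y => exists f : { f : quotient_space -> R | continuous_R f },
      (forall r, proj1_sig f r < 1 -> U r) /\ y f < 1); split.
    + intros y (f & fU & yf); exists (f :: nil), (1 - y f); split; [lra|].
      intros y' Hy'; exists f; split; [auto|].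
      specialize (Hy' f (or_introl eq_refl)); apply Rabs_def2 in Hy'; lra.
    + intros q; split.
      * intros Uq; destruct (tychonoff_clamped U q quotient_tychonoff oU Uq)
          as (f & cf & f0 & f1 & _); exists (exist _ f cf); simpl; split; [auto|lra].
      * intros (f & fU & yf); auto.
  - intros y ny; apply NNPP; intros H.
    pose (near := fun (l : list { f : quotient_space -> R | continuous_R f }) eps (p : K) =>
      exists h : adjoined p, forall f, In f l ->
        Rabs (proj1_sig f (quotient_class p h) - y f) < eps).
    destruct (compact_cluster_point
      (fun b => exists l eps, eps > 0 /\ b = near l eps) cK) as (p & Hp).
    + exists (near nil 1), nil, 1; split; [lra|auto].
    + intros b (l & eps & he & ->); apply NNPP; intros hb; apply H.
      exists l, eps; split; [auto|]; intros y' Hy' [q hq]; apply hb.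
      exists (proj1_sig q), (proj1 (proj2_sig q)); intros f i.
      rewrite quotient_class_val; specialize (Hy' f i); rewrite <- hq in Hy'; exact Hy'.
    + intros b b' (l & eps & he & ->) (l' & eps' & he' & ->).
      exists (near (l ++ l') (Rmin eps eps')); split.
      * exists (l ++ l'), (Rmin eps eps'); split; [apply Rmin_pos; auto|auto].
      * intros p [h Hp]; split; exists h; intros f i.
        -- eapply Rlt_le_trans; [apply Hp, in_or_app; auto|apply Rmin_l].
        -- eapply Rlt_le_trans; [apply Hp, in_or_app; auto|apply Rmin_r].
    + destruct (classic (adjoined p)) as [Ap|nA].
      * apply ny; exists (quotient_class p Ap).
        apply functional_extensionality; intros f.
        apply NNPP; intros ne; set (d := Rabs (proj1_sig f (quotient_class p Ap) - y f)).
        assert (hd : 0 < d) by (apply Rabs_pos_lt; lra).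
        destruct (continuous_R_near _ (proj2_sig f) (quotient_class p Ap) (d / 2))
          as (U & (W & oW & HW) & Up & HU); [lra|].
        destruct (Hp (near (f :: nil) (d / 2))
          ltac:(exists (f :: nil), (d / 2); split; [lra|auto]) W oW)
          as (q & Wq & Aq & Hq); [apply (HW p Ap); auto|].
        specialize (Hq f (or_introl eq_refl)); specialize (HU (quotient_class q Aq)).
        specialize (HU (proj2 (HW q Aq) Wq)).
        unfold d in HU, Hq; set (s := proj1_sig f (quotient_class q Aq)) in *.
        set (t := proj1_sig f (quotient_class p Ap)) in *.
        pose proof (Rabs_triang (- (s - t)) (s - y f)) as T; rewrite Rabs_Ropp in T.
        replace (- (s - t) + (s - y f)) with (t - y f) in T by ring; lra.
      * destruct (quotient_pole p nA) as (k & ck & kp & kpos & kpi & cq).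
        set (f := exist (fun f : quotient_space -> R => continuous_R f) _ cq).
        (* Close to p the function exceeds M, whereas the chosen points keep it within 1 of y f. *)
        set (M := Rabs (y f) + 1).
        assert (hM : 0 < M) by (unfold M; pose proof (Rabs_pos (y f)); lra).
        destruct (Hp (near (f :: nil) 1) ltac:(exists (f :: nil), 1; split; [lra|auto])
          (fun q => k q < / M)) as (q & kq & Aq & Hq).
        { apply (ck (fun t => t < / M)), R_open_lt. }
        { rewrite kp; apply Rinv_0_lt_compat; auto. }
        specialize (Hq f (or_introl eq_refl)); simpl in Hq.
        rewrite (kpi q Aq) in Hq; specialize (kpos q Aq).
        apply Rinv_lt_contravar in kq;
          [|apply Rmult_lt_0_compat; [|apply Rinv_0_lt_compat]; auto].
        rewrite Rinv_inv in kq; unfold M in kq; apply Rabs_def2 in Hq.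
        pose proof (Rle_abs (y f)); lra.
Qed.

Lemma quotient_in_RX : in_RX quotient_extension.
Proof. split; [apply quotient_realcompact|apply quotient_remainder_compact]. Qed.

(** If p is not in the class q, a function constant on classes is 0 on q and 1 at p, which
    [converges_value] forbids. *)
Lemma quotient_converges p (q : ext_sp quotient_extension) :
  converges e quotient_extension p q <-> adjoined p /\ pi p = proj1_sig q.
Proof.
  split.
  - intros H; apply NNPP; intros n.
    destruct (quotient_sep q (fun r => r <> p)) as (g & cg & g0 & g1 & cq).
    + apply closed_point; auto.
    + intros r hr ->; apply n; split; [apply adjoined_pi; rewrite hr; apply (proj2_sig q)|auto].
    + pose proof (converges_value e SC quotient_extension p q _ g H cq cg (fun x => eq_refl)) as h.
      rewrite g1 in h by tauto; lra.
  - intros [Ap hp] V (W & oW & HW) Vq; exists W; split; [auto|split].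
    + apply (HW p Ap); replace (quotient_class p Ap) with q; [auto|apply quotient_eq; auto].
    + intros x Wx; apply (saturated_trace_val V W (quotient_emb x) HW); auto.
Qed.

Lemma quotient_same_limit p q :
  same_limit e quotient_extension p q <-> adjoined p /\ adjoined q /\ pi p = pi q.
Proof.
  split.
  - intros (z & h1 & h2); apply quotient_converges in h1, h2.
    destruct h1 as [h1 ->], h2; auto.
  - intros (h1 & h2 & h3); exists (quotient_class p h1).
    split; apply quotient_converges; auto.
Qed.

End Realization.

(** * The order structure of R(X) *)

Definition RX_equiv {X : space} (a b : RX X) : Prop := RX_le a b /\ RX_le b a.

(** Phrased for a preorder: a is not largest, and everything above it is equivalent to it or
    largest. *)
Definition coatom {X : space} (a : RX X) : Prop :=
  (exists t, ~ RX_le t a) /\ forall b, RX_le a b -> RX_le b a \/ forall t, RX_le t b.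

(* Order-theoretic description of the coatoms that add a point to the remainder of the largest
   element: such a coatom is the only one above the extension where the new point is glued to an
   old one, whereas nothing strictly below a coatom that glues two old points has this property. *)
Definition point_coatom {X : space} (a : RX X) : Prop :=
  coatom a /\ exists b, RX_le b a /\ ~ RX_le a b /\
    forall c, coatom c -> RX_le b c -> RX_le a c.

Lemma RX_le_trans {X : space} (a b c : RX X) : RX_le a b -> RX_le b c -> RX_le a c.
Proof.
  intros (f & cf & hf) (g & cg & hg); exists (fun p => f (g p)); split.
  - intros V oV; apply (cg (fun p => V (f p))); auto.
  - intros x; rewrite hg; auto.
Qed.

(** * Transport of coatoms along an order isomorphism *)

Section OrderIso.
Context {X Y : space}.
Variables (F : RX X -> RX Y) (G : RX Y -> RX X).
Hypothesis mono : forall a b, RX_le a b <-> RX_le (F a) (F b).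
Hypothesis FG : forall c, RX_le c (F (G c)) /\ RX_le (F (G c)) c.

(** F and G are inverse only up to equivalence, so inequalities are moved across them as in an
    adjunction. *)
Lemma iso_le_left a c : RX_le (F a) c <-> RX_le a (G c).
Proof.
  rewrite mono; split; intros h; (eapply RX_le_trans; [exact h|]); apply FG.
Qed.

Lemma iso_le_right a c : RX_le c (F a) <-> RX_le (G c) a.
Proof.
  rewrite mono; split; intros h; (eapply RX_le_trans; [|exact h]); apply FG.
Qed.

Lemma iso_coatom a : coatom a <-> coatom (F a).
Proof.
  split; intros [[t ht] H]; split.
  - exists (F t); rewrite <- mono; auto.
  - intros b hb; apply iso_le_left in hb; destruct (H _ hb) as [h|h].
    + left; apply iso_le_right; auto.
    + right; intros s; apply RX_le_trans with (F (G s)); [apply FG|].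
      apply iso_le_left; auto.
  - exists (G t); rewrite <- iso_le_right; auto.
  - intros b hb; apply mono in hb; destruct (H _ hb) as [h|h].
    + left; apply mono; auto.
    + right; intros s; apply mono; auto.
Qed.

Lemma iso_coatom_inv c : coatom c -> coatom (G c).
Proof.
  intros [[t ht] H]; apply iso_coatom; split.
  - exists t; intros h; apply ht; apply RX_le_trans with (F (G c)); [auto|apply FG].
  - intros b hb; destruct (H b) as [h|h]; [|left|right; auto].
    + apply RX_le_trans with (F (G c)); [apply FG|auto].
    + apply RX_le_trans with c; [auto|apply FG].
Qed.

Lemma iso_point_coatom a : point_coatom a -> point_coatom (F a).
Proof.
  intros (ca & b & ba & nab & H); split; [apply iso_coatom; auto|].
  exists (F b); rewrite <- !mono; repeat split; auto.
  intros c cc bc; apply iso_le_left, H; [apply iso_coatom_inv; auto|].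
  apply iso_le_left; auto.
Qed.

End OrderIso.

(** * The order of R(X) read off relations on beta X *)

Section Order.
Context {X K : space}.
Variable e : X -> K.
Hypothesis SC : stone_cech X K e.
Hypothesis lc : locally_compact X.

Let cK : compact K := proj1 SC.
Let hK : hausdorff K := proj1 (proj2 SC).

(** The set C0 of the overview; [key_set] is its complement in beta X \ X. *)
Definition core : K -> Prop := closure (fun q => in_upsilon e q /\ ~ exists x, e x = q).

Definition limits (a : RX X) : K -> K -> Prop := same_limit e (proj1_sig a).

Definition admissible (C : K -> Prop) : Prop :=
  is_closed C /\ (forall p, C p -> ~ in_image e p) /\ forall p, core p -> C p.

(** Local compactness makes X open in beta X, so the closure of upsilon X \ X stays off X. *)
Lemma core_admissible : admissible core.
Proof.
  split; [apply closed_closure|split; [|auto]].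
  apply closure_min; [apply closed_not, (image_open e SC lc)|].
  intros p [_ h]; exact h.
Qed.

Lemma admissible_upsilon C p : admissible C -> in_upsilon e p -> in_image e p \/ C p.
Proof.
  intros (_ & _ & H) hp; destruct (classic (in_image e p)) as [h|h]; [auto|].
  right; apply H, closure_incl; auto.
Qed.

Lemma admissible_add p : key_set e p -> admissible (fun q => core q \/ q = p).
Proof.
  intros [h1 h2]; destruct core_admissible as (c & d & _); split; [|split].
  - apply closed_or; [auto|apply closed_point; auto].
  - intros q [h| ->]; auto.
  - auto.
Qed.

Lemma RX_le_limits a b : RX_le a b <-> forall p q, limits b p q -> limits a p q.
Proof. apply ext_le_same_limit; auto. Qed.

Lemma limits_domain_closed a : is_closed (fun p => limits a p p /\ ~ in_image e p).
Proof.
  pose proof (limit_domain_closed e SC (proj1_sig a) (image_open e SC lc)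
    (proj2 (proj2_sig a))) as H.
  apply open_ext with (2 := H); intros p; unfold limit_domain, limits, same_limit.
  split; intros n [(y & h) nX]; apply n; split; auto; exists y; tauto.
Qed.

(** Both conditions defining R(X) are used: realcompactness puts upsilon X \ X into the domain, and
    compactness of the remainder makes the domain closed off X. *)
Lemma limits_core a p : core p -> limits a p p.
Proof.
  intros hp; refine (proj1 (closure_min _ _ (limits_domain_closed a) _ p hp)).
  intros q [uq nq]; split; [|auto].
  destruct (upsilon_converges e SC (proj1_sig a) q (proj1 (proj2_sig a)) uq) as [y hy].
  exists y; auto.
Qed.

Lemma limits_adjoined_core a p : adjoined e core p -> limits a p p.
Proof. intros [[x <-]|h]; [apply same_limit_image; auto|apply limits_core; auto]. Qed.

Lemma limits_distinct a p q : limits a p q -> p <> q -> ~ in_image e p /\ ~ in_image e q.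
Proof.
  intros h ne; split; intros [x <-]; apply ne.
  - symmetry; apply (same_limit_image_eq e SC (proj1_sig a)); auto.
  - apply (same_limit_image_eq e SC (proj1_sig a)), same_limit_sym; auto.
Qed.

Lemma limits_only_core a p : limits a p p -> (forall q, key_set e q -> ~ limits a q q) ->
  adjoined e core p.
Proof.
  intros h H; destruct (classic (adjoined e core p)) as [|n]; [auto|].
  exfalso; apply (H p); [|auto]; split; intros c; apply n; [left|right]; auto.
Qed.

Lemma realize_subspace C : admissible C ->
  exists a : RX X, forall p q, limits a p q <-> adjoined e C p /\ p = q.
Proof.
  intros aC; pose proof aC as (cC & CX & _).
  assert (sep : forall z (W : K -> Prop), is_open W -> (forall p, p = z -> W p) ->
    exists g : K -> R, continuous_R g /\ g z = 0 /\ (forall p, ~ W p -> g p = 1) /\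
      forall p, g p = g p).
  { intros z W oW HW.
    destruct (urysohn (fun p => p = z) (fun p => ~ W p) cK hK (closed_point z hK)
      (closed_not W oW)) as (g & cg & _ & g0 & g1).
    { intros p [-> n]; apply n; auto. }
    exists g; auto. }
  exists (exist _ _ (quotient_in_RX e SC C (image_open e SC lc) cC CX
    (fun p => admissible_upsilon C p aC) (fun p => p) (fun p => eq_refl) (fun p h => h)
    (fun p _ => eq_refl) sep)).
  intros p q; unfold limits; simpl; rewrite quotient_same_limit by auto.
  split; [tauto|intros [h <-]; auto].
Qed.

Lemma realize_gluing C a b : admissible C -> C a -> C b ->
  exists r : RX X, forall p q, limits r p q <->
    adjoined e C p /\ adjoined e C q /\ (p = q \/ ((p = a \/ p = b) /\ (q = a \/ q = b))).
Proof.
  intros aC Ca Cb; pose proof aC as (cC & CX & _).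
  pose (pi := fun p => if excluded_middle_informative (p = b) then a else p).
  assert (pib : pi b = a).
  { unfold pi; destruct (excluded_middle_informative _); tauto. }
  assert (pin : forall p, p <> b -> pi p = p).
  { intros p n; unfold pi; destruct (excluded_middle_informative _); tauto. }
  assert (pia : pi a = a).
  { destruct (classic (a = b)) as [h|h]; [rewrite h at 1; auto|auto]. }
  assert (idem : forall p, pi (pi p) = pi p).
  { intros p; destruct (classic (p = b)) as [->|h];
      [rewrite pib; auto|rewrite !(pin p h); auto]. }
  assert (inC : forall p, C p -> C (pi p)).
  { intros p; destruct (classic (p = b)) as [->|h]; [rewrite pib|rewrite pin]; auto. }
  assert (out : forall p, ~ C p -> pi p = p) by (intros p n; apply pin; intros ->; auto).
  assert (sep : forall z (W : K -> Prop), is_open W -> (forall p, pi p = pi z -> W p) ->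
    exists g : K -> R, continuous_R g /\ g z = 0 /\ (forall p, ~ W p -> g p = 1) /\
      forall p, g (pi p) = g p).
  { intros z W oW HW.
    assert (cab : is_closed (fun p => p = a \/ p = b))
      by (apply closed_or; apply closed_point; auto).
    assert (fin : forall g : K -> R, g a = g b -> forall p, g (pi p) = g p).
    { intros g h p; destruct (classic (p = b)) as [->|n]; [rewrite pib|rewrite pin]; auto. }
    destruct (classic (z = a \/ z = b)) as [hz|hz].
    (* For the class of a and b, the Urysohn function must vanish at both points; for any other
       class, it is required to be 1 at both. Either way it is constant on the glued pair. *)
    - assert (pz : pi z = a) by (destruct hz as [->| ->]; auto).
      destruct (urysohn (fun p => p = a \/ p = b) (fun p => ~ W p) cK hK cab (closed_not W oW))
        as (g & cg & _ & g0 & g1).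
      { intros p [[-> | ->] n]; apply n, HW; rewrite pz; auto. }
      exists g; repeat split; auto; apply fin; rewrite !g0; auto.
    - destruct (urysohn (fun p => p = z) (fun p => ~ W p \/ (p = a \/ p = b)) cK hK
        (closed_point z hK) (closed_or _ _ (closed_not W oW) cab)) as (g & cg & _ & g0 & g1).
      { intros p [-> [n|n]]; [apply n; auto|auto]. }
      exists g; repeat split; auto; apply fin; rewrite !g1; auto. }
  exists (exist _ _ (quotient_in_RX e SC C (image_open e SC lc) cC CX
    (fun p => admissible_upsilon C p aC) pi idem inC out sep)).
  intros p q; unfold limits; simpl; rewrite quotient_same_limit by auto.
  apply and_iff_compat_l, and_iff_compat_l.
  destruct (classic (p = b)) as [->|np]; destruct (classic (q = b)) as [->|nq].
  - tauto.
  - rewrite pib, (pin q nq); intuition congruence.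
  - rewrite pib, (pin p np); intuition congruence.
  - rewrite (pin p np), (pin q nq); intuition congruence.
Qed.

(** With an empty core the empty set is admissible; the resulting realcompact extension adds no
    point, so it is X itself. *)
Lemma core_nonempty : ~ realcompact X -> exists p, core p.
Proof.
  intros nr; apply NNPP; intros n.
  assert (cX : is_closed (fun _ : K => False)).
  { apply open_ext with (fun _ => True); [tauto|apply open_full]. }
  destruct (realize_subspace (fun _ => False)) as [[E [rE rem]] HE].
  { split; [auto|split; [tauto|]]; intros p hp; apply n; eauto. }
  unfold limits in HE; simpl in HE.
  assert (sur : forall y, exists x, ext_emb E x = y).
  { intros y; destruct (converges_surjective e SC E y) as [p Hp].
    destruct (proj1 (HE p p)) as [[[x <-]|[]] _]; [exists y; auto|].
    exists x; apply (converges_unique e SC E (e x)); [apply converges_image|]; auto. }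
  apply nr; destruct rE as (I & h & h1 & h2 & h3 & h4).
  destruct (ext_embedding X E) as (m1 & m2 & m3).
  exists I, (fun x => h (ext_emb E x)); split; [|split; [|split]].
  - intros V oV; apply (m1 (fun y => V (h y))); auto.
  - intros x y hxy; apply m2, h2; auto.
  - intros U oU; destruct (m3 U oU) as (V & oV & HV); destruct (h3 V oV) as (W & oW & HW).
    exists W; split; [auto|]; intros x; rewrite HV; apply HW.
  - intros y ny; destruct (h4 y) as (l & eps & he & H).
    + intros [z hz]; apply ny; destruct (sur z) as [x <-]; eauto.
    + exists l, eps; split; [auto|]; intros y' Hy' [x hx]; apply (H y' Hy'); eauto.
Qed.

(* [adds_point p a]: a is equivalent to the extension X u cl(upsilon X \ X) u {p}. *)
Definition adds_point (p : K) (a : RX X) : Prop :=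
  forall q r, limits a q r <-> adjoined e (fun s => core s \/ s = p) q /\ q = r.

Lemma adds_point_exists p : key_set e p -> exists a, adds_point p a.
Proof. intros hp; apply realize_subspace, admissible_add; auto. Qed.

(** Every element of R(X) has X u [core] in its domain, so containment of relations is decided at p
    alone. *)
Lemma adds_point_le p a b : adds_point p a -> (RX_le b a <-> limits b p p).
Proof.
  intros Ha; rewrite RX_le_limits; split; intros h.
  - apply h, Ha; split; [right; right|]; auto.
  - intros q r hq; apply Ha in hq; destruct hq as [[hq|[hq| ->]] <-]; auto;
      apply limits_adjoined_core; [left|right]; auto.
Qed.

Lemma adds_point_equiv p a b : adds_point p a -> RX_equiv a b -> adds_point p b.
Proof.
  intros Ha [h1 h2] q r; rewrite <- (Ha q r).
  split; apply RX_le_limits; auto.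
Qed.

Lemma adds_point_inj p q a b : key_set e p -> adds_point p a -> adds_point q b ->
  RX_le b a -> p = q.
Proof.
  intros kp Ha Hb h; apply (adds_point_le p a b Ha), Hb in h.
  destruct h as [[h|[h|h]] _]; [contradiction (proj1 kp h)|contradiction (proj2 kp h)|auto].
Qed.

Lemma largest_exists : exists t : RX X, forall p q, limits t p q <-> adjoined e core p /\ p = q.
Proof. apply realize_subspace, core_admissible. Qed.

Lemma le_largest b : (forall p q, limits b p q -> adjoined e core p /\ p = q) ->
  forall t, RX_le t b.
Proof.
  intros H t; apply RX_le_limits; intros p q h; apply H in h; destruct h as [h <-].
  apply limits_adjoined_core; auto.
Qed.

Lemma adds_point_not_largest p a : key_set e p -> adds_point p a -> exists t, ~ RX_le t a.
Proof.
  intros kp Ha; destruct largest_exists as [t Ht]; exists t.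
  rewrite (adds_point_le p a t Ha), Ht; intros [[h|h] _]; [exact (proj1 kp h)|exact (proj2 kp h)].
Qed.

Lemma adds_point_coatom p a : key_set e p -> adds_point p a -> coatom a.
Proof.
  intros kp Ha; split; [apply (adds_point_not_largest p); auto|]; intros b ab.
  rewrite RX_le_limits in ab.
  destruct (classic (limits b p p)) as [h|n]; [left; apply (adds_point_le p); auto|right].
  apply le_largest; intros q r hqr; pose proof hqr as hqr'.
  apply ab, Ha in hqr'; destruct hqr' as [[h|[h| ->]] <-]; split; auto;
    [left|right|contradiction]; auto.
Qed.

Lemma coatom_below_point p a c : key_set e p -> adds_point p a -> coatom c -> limits c p p ->
  RX_equiv a c.
Proof.
  intros kp Ha [_ cc] h; apply (adds_point_le p a c Ha) in h; split; [|auto].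
  destruct (cc a h) as [|h']; [auto|].
  destruct (adds_point_not_largest p a kp Ha) as [t ht]; contradiction (ht (h' t)).
Qed.

Lemma adds_point_point_coatom p a : ~ realcompact X -> key_set e p -> adds_point p a ->
  point_coatom a.
Proof.
  intros nr kp Ha; split; [apply (adds_point_coatom p); auto|].
  destruct (core_nonempty nr) as [z cz].
  assert (zp : z <> p) by (intros ->; exact (proj2 kp cz)).
  destruct (realize_gluing _ p z (admissible_add p kp)) as [b Hb]; [auto|auto|].
  exists b; split; [|split].
  - apply (adds_point_le p); auto; apply Hb; unfold adjoined; auto 10.
  - rewrite RX_le_limits; intros h; apply zp.
    assert (hb : limits b z p) by (apply Hb; unfold adjoined; auto 10).
    apply h, Ha in hb; apply hb.
  - intros c cc bc; rewrite RX_le_limits in bc.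
    destruct (classic (limits c p p)) as [h|n]; [apply (proj1 (coatom_below_point p a c kp Ha cc h))|].
    (* Away from p the relation of b is the identity on X u [core], so a coatom above b without p in
       its domain would be largest. *)
    exfalso; destruct cc as [[t ht] _]; apply ht, le_largest; intros q r hqr.
    assert (nq : q <> p) by (intros h; rewrite h in hqr; exact (n (same_limit_left _ _ _ _ hqr))).
    assert (nr' : r <> p) by (intros h; rewrite h in hqr; exact (n (same_limit_right _ _ _ _ hqr))).
    apply bc, Hb in hqr; destruct hqr as (h1 & h2 & h3); split.
    + destruct h1 as [h|[h|h]]; [left|right|contradiction]; auto.
    + destruct h3 as [h|[[h|h] [h'|h']]]; congruence.
Qed.

(** Apart from the diagonal of X u [core], the relation of a has only the pair p, q. An element
    above a either keeps this pair and is equivalent to a, or loses it and is largest. *)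
Lemma gluing_coatom p q a : core p -> core q -> p <> q ->
  (forall u v, limits a u v <-> adjoined e core u /\ adjoined e core v /\
     (u = v \/ ((u = p \/ u = q) /\ (v = p \/ v = q)))) -> coatom a.
Proof.
  intros cp cq ne Ha.
  assert (apq : limits a p q) by (apply Ha; unfold adjoined; auto 10).
  split.
  - destruct largest_exists as [t Ht]; exists t; rewrite RX_le_limits; intros h.
    apply h, Ht in apq; tauto.
  - intros b ab; rewrite RX_le_limits in ab.
    destruct (classic (limits b p q)) as [h|n].
    + left; rewrite RX_le_limits; intros u v huv; apply Ha in huv.
      destruct huv as (h1 & h2 & [<-|[[-> | ->] [-> | ->]]]); auto;
        try apply limits_adjoined_core; auto; apply same_limit_sym; auto.
    + right; apply le_largest; intros u v huv; pose proof huv as h; apply ab, Ha in h.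
      destruct h as (h1 & h2 & [<-|[[-> | ->] [-> | ->]]]); auto; exfalso; apply n; auto.
      apply same_limit_sym; auto.
Qed.

(** Suppose no key point is in the domain of a. Then none is in the domain of b, since its coatom
    would be above b and hence above a. So every pair of distinct points related by b lies in
    [core], the coatom gluing it is above b and hence above a, and a relates the pair too. This
    gives a <= b, a contradiction. *)
Lemma point_coatom_adds_point a : point_coatom a -> exists p, key_set e p /\ adds_point p a.
Proof.
  intros (ca & b & ba & nab & H).
  assert (Hp : forall p, key_set e p -> limits a p p -> adds_point p a).
  { intros p kp h; destruct (adds_point_exists p kp) as [c Hc].
    apply (adds_point_equiv p c); [auto|apply (coatom_below_point p); auto]. }
  destruct (classic (exists p, key_set e p /\ limits a p p)) as [(p & kp & h)|n]; [eauto|].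
  exfalso; rewrite RX_le_limits in ba, nab.
  assert (nb : forall p, key_set e p -> ~ limits b p p).
  { intros p kp h; apply n; exists p; split; [auto|].
    destruct (adds_point_exists p kp) as [c Hc].
    apply (adds_point_le p c a Hc), H; [apply (adds_point_coatom p); auto|].
    apply (adds_point_le p); auto. }
  apply nab; intros p q hpq.
  pose proof (limits_only_core b p (same_limit_left _ _ _ _ hpq) nb) as Ap.
  pose proof (limits_only_core b q (same_limit_right _ _ _ _ hpq) nb) as Aq.
  destruct (classic (p = q)) as [<-|ne]; [apply limits_adjoined_core; auto|].
  destruct (limits_distinct b p q hpq ne) as [np nq].
  destruct Ap as [|cp]; [contradiction|]; destruct Aq as [|cq]; [contradiction|].
  destruct (realize_gluing core p q core_admissible cp cq) as [c Hc].
  assert (ac : RX_le a c).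
  { apply H; [apply (gluing_coatom p q); auto|].
    rewrite RX_le_limits; intros u v huv; apply Hc in huv.
    destruct huv as (h1 & h2 & [<-|[[-> | ->] [-> | ->]]]); auto;
      try apply limits_adjoined_core; auto; apply same_limit_sym; auto. }
  apply (proj1 (RX_le_limits a c) ac), Hc; unfold adjoined; auto 10.
Qed.

(** The adjoined set consists of [core] and the part of beta X \ X outside V. Thus the traces of
    open sets on the key set are visible in the order. *)
Lemma realize_key_open (V : K -> Prop) : is_open V ->
  exists a : RX X, forall p, key_set e p -> (V p <-> ~ limits a p p).
Proof.
  intros oV; destruct core_admissible as (c & d & _).
  destruct (realize_subspace (fun p => ~ in_image e p /\ (core p \/ ~ V p))) as [a Ha].
  - split; [|split; [tauto|auto]].
    apply closed_and; [apply closed_not, (image_open e SC lc)|].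
    apply closed_or; [auto|apply closed_not; auto].
  - exists a; intros p [k1 k2]; rewrite Ha; split.
    + intros Vp [[h|[_ [h|h]]] _]; auto.
    + intros h; apply NNPP; intros nV; apply h; split; [right|]; auto.
Qed.

End Order.

(** * The homeomorphism induced by an order isomorphism *)

Section Transfer.
Context {X K Y L : space}.
Variables (eX : X -> K) (eY : Y -> L).
Hypotheses (SCX : stone_cech X K eX) (SCY : stone_cech Y L eY).
Hypotheses (lcX : locally_compact X) (lcY : locally_compact Y).
Hypothesis nrX : ~ realcompact X.
Variables (F : RX X -> RX Y) (G : RX Y -> RX X).
Hypothesis mono : forall a b, RX_le a b <-> RX_le (F a) (F b).
Hypothesis FG : forall c, RX_le c (F (G c)) /\ RX_le (F (G c)) c.

(** Quantifying over all a that represent p avoids a choice within the equivalence class. *)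
Definition corresponds (p : K) (q : L) : Prop :=
  forall a, adds_point eX p a -> adds_point eY q (F a).

Lemma corresponds_exists p : key_set eX p -> exists q, key_set eY q /\ corresponds p q.
Proof.
  intros kp; destruct (adds_point_exists eX SCX lcX p kp) as [a Ha].
  destruct (point_coatom_adds_point eY SCY lcY (F a)) as (q & kq & Hq).
  - apply (iso_point_coatom F G mono FG), (adds_point_point_coatom eX SCX lcX p); auto.
  - exists q; split; [auto|]; intros b Hb; apply (adds_point_equiv eY SCY q (F a)); [auto|].
    split; apply (proj1 (mono _ _)); apply (RX_le_limits eX SCX); intros u v h;
      [apply Ha, Hb, h|apply Hb, Ha, h].
Qed.

(** A key point is in the domain of a exactly when its coatom is above a, a condition that F
    preserves. *)
Lemma corresponds_limits p q a : key_set eX p -> corresponds p q ->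
  (limits eX a p p <-> limits eY (F a) q q).
Proof.
  intros kp H; destruct (adds_point_exists eX SCX lcX p kp) as [b Hb].
  rewrite <- (adds_point_le eX SCX lcX p b a Hb).
  rewrite <- (adds_point_le eY SCY lcY q (F b) (F a) (H b Hb)); apply mono.
Qed.

(** V cuts out the key points missing from the domain of some a. The corresponding points are those
    missing from the domain of F a, which is closed off Y. *)
Lemma corresponds_open (V : K -> Prop) : is_open V ->
  exists U : L -> Prop, is_open U /\
    forall p q, key_set eX p -> key_set eY q -> corresponds p q -> (V p <-> U q).
Proof.
  intros oV; destruct (realize_key_open eX SCX lcX V oV) as [a Ha].
  exists (fun q => ~ (limits eY (F a) q q /\ ~ in_image eY q)); split.
  - apply limits_domain_closed; auto.
  - intros p q kp kq H; rewrite (Ha p kp), (corresponds_limits p q a kp H).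
    destruct kq as [nq _]; unfold in_image; tauto.
Qed.

End Transfer.

Lemma corresponds_inverse {X K Y L : space} (eX : X -> K) (eY : Y -> L)
  (F : RX X -> RX Y) (G : RX Y -> RX X) p q r :
  stone_cech X K eX -> locally_compact X -> key_set eX p ->
  (forall a, RX_le a (G (F a)) /\ RX_le (G (F a)) a) ->
  corresponds eX eY F p q -> corresponds eY eX G q r -> r = p.
Proof.
  intros SC lc kp GF H1 H2; destruct (adds_point_exists eX SC lc p kp) as [a Ha].
  symmetry; apply (adds_point_inj eX SC lc p r a (G (F a))); auto; apply GF.
Qed.

Theorem theorem3p12 (X Y : space) :
  tychonoff X -> tychonoff Y ->
  locally_compact X -> locally_compact Y ->
  ~ realcompact X -> ~ realcompact Y ->
  forall (bX : space) (eX : X -> bX) (bY : space) (eY : Y -> bY),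
    stone_cech X bX eX -> stone_cech Y bY eY ->
    RX_order_isomorphic X Y ->
    homeomorphic_subspaces (key_set eX) (key_set eY).
Proof.
  intros _ _ lcX lcY nrX nrY bX eX bY eY SCX SCY (F & G & mono & GF & FG).
  (* With this, the correspondence can also be built from G, in the direction from Y to X. *)
  assert (mono' : forall a b, RX_le a b <-> RX_le (G a) (G b)).
  { intros a b; rewrite <- (iso_le_left F G mono FG).
    split; intros h; (eapply RX_le_trans; [|exact h]); apply FG. }
  assert (Hf : forall p : {p | key_set eX p}, exists q : {q | key_set eY q},
    corresponds eX eY F (proj1_sig p) (proj1_sig q)).
  { intros [p kp].
    destruct (corresponds_exists eX eY SCX SCY lcX lcY nrX F G mono FG p kp) as (q & kq & H).
    exists (exist _ q kq); auto. }
  assert (Hg : forall q : {q | key_set eY q}, exists p : {p | key_set eX p},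
    corresponds eY eX G (proj1_sig q) (proj1_sig p)).
  { intros [q kq].
    destruct (corresponds_exists eY eX SCY SCX lcY lcX nrY G F mono' GF q kq) as (p & kp & H).
    exists (exist _ p kp); auto. }
  destruct (choice _ Hf) as [f cf]; destruct (choice _ Hg) as [g cg].
  assert (gf : forall a, g (f a) = a).
  { intros a; apply eq_sig_hprop; [intros; apply proof_irrelevance|].
    apply (corresponds_inverse eX eY F G (proj1_sig a) (proj1_sig (f a))); auto.
    apply (proj2_sig a). }
  assert (fg : forall b, f (g b) = b).
  { intros b; apply eq_sig_hprop; [intros; apply proof_irrelevance|].
    apply (corresponds_inverse eY eX G F (proj1_sig b) (proj1_sig (g b))); auto.
    apply (proj2_sig b). }
  exists f, g; repeat split; auto.
  - intros V oV.
    (* Continuity of f comes from the correspondence for G: it carries open sets of bY to open sets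
       of bX, and f a corresponds to g (f a) = a. *)
    destruct (corresponds_open eY eX SCY SCX lcY lcX G mono' V oV) as (U & oU & HU).
    exists U; split; [auto|]; intros a; apply HU; try apply proj2_sig.
    rewrite <- (gf a) at 2; apply cg.
  - intros V oV.
    destruct (corresponds_open eX eY SCX SCY lcX lcY F mono V oV) as (U & oU & HU).
    exists U; split; [auto|]; intros b; apply HU; try apply proj2_sig.
    rewrite <- (fg b) at 2; apply cf.
Qed.
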